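(* Let $I=[0,1]$ or $I=[0,\infty)$ and let $X$ be a Banach function space on $I$. If the Volterra space $VX$ is nontrivial (i.e. $VX\neq\{0\}$), then it contains an asymptotically isometric copy of $\ell^1$ and, consequently, fails the fixed point property.
   Context: $L^0(I)$ is the space of (a.e. equivalence classes of) real-valued Lebesgue measurable functions on $I$. A Banach function space $X$ on $I$ is a Banach space that is a linear subspace of $L^0(I)$ with the ideal property: $|f|\le|g|$ a.e., $f\in L^0(I)$, $g\in X$ imply $f\in X$ and $\|f\|_X\le\|g\|_X$; by convention $X$ is also assumed to contain a function positive a.e. on $I$ (this is not assumed for the derived space $VX$). Volterra operator: $Vf(x)=\int_0^xf(t)\,dt$ for $x\in I$. $VX=\{f\in L^0(I): V|f|\in X\}$ with norm $\|f\|_{VX}=\|V|f|\|_X$. A Banach space $E$ contains an asymptotically isometric copy of $\ell^1$ if there are sequences $(x_n)\subset E$ and $(\varepsilon_n)\subset(0,1)$ with $\varepsilon_n\to0$ such that $\sum_{n}(1-\varepsilon_n)|\alpha_n|\le\|\sum_{n}\alpha_nx_n\|_E\le\sum_{n}|\alpha_n|$ for each $(\alpha_n)\in\ell^1$. $E$ has the fixed point property if for every nonempty closed bounded convex $K\subset E$, every nonexpansive map $S:K\to K$ ($\|S(x)-S(y)\|\le\|x-y\|$ for all $x,y\in K$) has a fixed point. *)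

(* Defs.v *)
From HB Require Import structures.
From mathcomp Require Import all_boot all_order all_algebra.
From mathcomp Require Import all_classical all_reals all_analysis.
From mathcomp Require Import measurable_realfun.

Set Implicit Arguments.
Unset Strict Implicit.
Unset Printing Implicit Defensive.

Import Order.TTheory GRing.Theory Num.Theory.
Import numFieldNormedType.Exports.
Local Open Scope classical_set_scope.
Local Open Scope ring_scope.
Local Open Scope quotient_scope.

(* The real line with the Caratheodory sigma-algebra, so that measurable means
   Lebesgue measurable rather than Borel measurable. *)
Definition lebesgue_line (R : realType) : measurableType _ :=
  caratheodory_type (@wlength R idfun)^*%mu.

Definition lebesgue (R : realType) : {measure set (lebesgue_line R) -> \bar R} :=
  @completed_lebesgue_measure R.

Lemma borel_measurable_lebesgue (R : realType) (A : set R) :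
  measurable A -> measurable (A : set (lebesgue_line R)).
Proof. exact: sub_caratheodory. Qed.

Variant volterra_domain := unit_interval | half_line.

Definition domain_set (R : realType) (I : volterra_domain) :
    set (lebesgue_line R) :=
  match I with
  | unit_interval => `[0%R : R, 1%R : R]
  | half_line => `[0%R : R, +oo[
  end.

Arguments domain_set : clear implicits.

Lemma domain_setE (R : realType) (I : volterra_domain) :
  domain_set R I = `[0%R : R, 1%R : R]%classic \/
  domain_set R I = `[0%R : R, +oo[%classic.
Proof. by case: I; [left|right]. Qed.

Lemma measurable_domain (R : realType) (I : volterra_domain) :
  measurable (domain_set R I).
Proof. by case: I; apply: borel_measurable_lebesgue; exact: measurable_itv. Qed.

Arguments measurable_domain : clear implicits.

(* L^0(I) is obtained from functions on the whole line by working with the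
   Lebesgue measure restricted to I: values outside I are irrelevant. *)
Definition lebesgue_on (R : realType) (I : volterra_domain) :
    {measure set (lebesgue_line R) -> \bar R} :=
  mrestr (lebesgue R) (measurable_domain R I).

Arguments lebesgue_on : clear implicits.

Lemma ae_lebesgue_onP (R : realType) (I : volterra_domain)
    (P : lebesgue_line R -> Prop) :
  (\forall x \ae lebesgue_on R I, P x) <->
  (\forall x \ae lebesgue R, domain_set R I x -> P x).
Proof.
have mD := measurable_domain R I; split=> -[N [mN N0 PN]].
  exists (N `&` domain_set R I); split => //; first exact: measurableI.
  by move=> x /= /not_implyP[Dx Px]; split=> //; apply: PN.
exists (N `|` ~` domain_set R I); split => //.
- by apply: measurableU => //; exact: measurableC.
- rewrite /lebesgue_on /= /mrestr setIUl setICl setU0.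
  by apply: subset_measure0 N0 => //; exact: measurableI.
- move=> x /= Px; have [Dx|] := pselect (domain_set R I x); last by right.
  by left; apply: PN => /= /(_ Dx).
Qed.

Section L0.
Context d (T : measurableType d) (R : realType)
  (mu : {measure set T -> \bar R}).

Definition L0 : Type := {mfun_ mu, T >-> R}.

HB.instance Definition _ := Choice.on L0.
HB.instance Definition _ := EqQuotient.on L0.

Definition L0_repr (f : L0) : {mfun T >-> R} := repr f.
Definition L0_fun (f : L0) : T -> R := L0_repr f.
Coercion L0_fun : L0 >-> Funclass.

Lemma L0_measurable (f : L0) : measurable_fun setT f.
Proof. exact: (@measurable_funPT _ _ _ _ (L0_repr f)). Qed.

Definition L0_class (f : T -> R) (mf : measurable_fun setT f) : L0 :=
  \pi_L0 (mfun_Sub (mem_set mf) : {mfun T >-> R}).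

Lemma L0_classK (f : T -> R) (mf : measurable_fun setT f) :
  \forall x \ae mu, L0_class mf x = f x.
Proof.
have : (repr (L0_class mf) == mfun_Sub (mem_set mf) %[mod L0])%qT
  by rewrite reprK.
by rewrite eqmodE => /asboolP; apply: filterS => x /(_ I).
Qed.

Lemma L0_eqP (f g : L0) : f = g <-> (\forall x \ae mu, f x = g x).
Proof.
split=> [-> |fg]; first exact: aeW.
rewrite -[f]reprK -[g]reprK; apply/eqP; rewrite eqmodE; apply/asboolP.
by apply: filterS fg.
Qed.

Let add (f g : L0) : L0 :=
  L0_class (measurable_funD (L0_measurable f) (L0_measurable g)).
Let opp (f : L0) : L0 := L0_class (measurable_funN (L0_measurable f)).
Let zero : L0 := L0_class (measurable_cst (0 : R)).
Let scale (a : R) (f : L0) : L0 :=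
  L0_class (measurable_funM (measurable_cst a) (L0_measurable f)).

Let addE f g : \forall x \ae mu, add f g x = f x + g x.
Proof. exact: L0_classK. Qed.
Let oppE f : \forall x \ae mu, opp f x = - f x.
Proof. exact: L0_classK. Qed.
Let zeroE : \forall x \ae mu, zero x = 0.
Proof. exact: L0_classK. Qed.
Let scaleE a f : \forall x \ae mu, scale a f x = a * f x.
Proof. exact: L0_classK. Qed.

Let addA : associative add.
Proof.
move=> f g h; apply/L0_eqP.
apply: filterS3 (addE f (add g h)) (addE g h) (filterI (addE (add f g) h) (addE f g)).
by move=> x -> -> [-> ->]; rewrite addrA.
Qed.
Let addC : commutative add.
Proof.
move=> f g; apply/L0_eqP; apply: filterS2 (addE f g) (addE g f).
by move=> x -> ->; rewrite addrC.
Qed.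
Let add0 : left_id zero add.
Proof.
move=> f; apply/L0_eqP; apply: filterS2 (addE zero f) zeroE.
by move=> x -> ->; rewrite add0r.
Qed.
Let addN : left_inverse zero opp add.
Proof.
move=> f; apply/L0_eqP; apply: filterS3 (addE (opp f) f) (oppE f) zeroE.
by move=> x -> -> ->; rewrite addNr.
Qed.

HB.instance Definition _ := GRing.isZmodule.Build L0 addA addC add0 addN.

Let scaleA a b (f : L0) : scale a (scale b f) = scale (a * b) f.
Proof.
apply/L0_eqP.
apply: filterS3 (scaleE a (scale b f)) (scaleE b f) (scaleE (a * b) f).
by move=> x -> -> ->; rewrite mulrA.
Qed.
Let scale1 : left_id 1 scale.
Proof.
move=> f; apply/L0_eqP; apply: filterS (scaleE 1 f).
by move=> x ->; rewrite mul1r.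
Qed.
Let scaleDr : right_distributive scale +%R.
Proof.
move=> a f g; apply/L0_eqP.
apply: filterS3 (scaleE a (f + g)) (addE f g)
  (filterI (addE (scale a f) (scale a g)) (filterI (scaleE a f) (scaleE a g))).
by move=> x -> + [-> [-> ->]] => ->; rewrite mulrDr.
Qed.
Let scaleDl (f : L0) : {morph scale^~ f : a b / a + b >-> a + b}.
Proof.
move=> a b; apply/L0_eqP.
apply: filterS3 (scaleE (a + b) f) (addE (scale a f) (scale b f))
  (filterI (scaleE a f) (scaleE b f)).
by move=> x -> -> [-> ->]; rewrite mulrDl.
Qed.

HB.instance Definition _ :=
  GRing.Zmodule_isLmodule.Build R L0 scaleA scale1 scaleDr scaleDl.

Lemma L0_addE (f g : L0) : \forall x \ae mu, (f + g : L0) x = f x + g x.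
Proof. exact: addE. Qed.
Lemma L0_oppE (f : L0) : \forall x \ae mu, (- f : L0) x = - f x.
Proof. exact: oppE. Qed.
Lemma L0_zeroE : \forall x \ae mu, (0 : L0) x = 0.
Proof. exact: zeroE. Qed.
Lemma L0_scaleE (a : R) (f : L0) :
  \forall x \ae mu, (a *: f : L0) x = a * f x.
Proof. exact: scaleE. Qed.

End L0.
Arguments L0 {d T R} mu.


(* A linear subspace of V together with a norm on it; ns_norm is only meaningful
   on the carrier. *)
Record normed_subspace (R : realType) (V : lmodType R) := NormedSubspace {
  ns_carrier :> {pred V};
  ns_norm : V -> R;
  ns_submod_closed : submod_closed ns_carrier;
  ns_normD : {in ns_carrier &, forall x y,
    ns_norm (x + y) <= ns_norm x + ns_norm y};
  ns_normZ : forall a, {in ns_carrier, forall x,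
    ns_norm (a *: x) = `|a| * ns_norm x};
  ns_norm_eq0 : {in ns_carrier, forall x, ns_norm x = 0 -> x = 0}
}.

Section ns_type.
Variables (R : realType) (V : lmodType R) (X : normed_subspace V).

HB.instance Definition _ :=
  GRing.isSubmodClosed.Build R V (ns_carrier X) (ns_submod_closed X).

Record ns_type := NsType { ns_val : V; ns_valP : ns_val \in ns_carrier X }.

HB.instance Definition _ := [isSub for ns_val].
HB.instance Definition _ := [Choice of ns_type by <:].
HB.instance Definition _ := [SubChoice_isSubLmodule of ns_type by <:].

Let norm (x : ns_type) : R := ns_norm X (ns_val x).
Let norm_D x y : norm (x + y) <= norm x + norm y.
Proof. by apply: ns_normD; exact: ns_valP. Qed.
Let norm_Z a x : norm (a *: x) = `|a| * norm x.
Proof. by apply: ns_normZ; exact: ns_valP. Qed.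
Let norm_eq0 x : norm x = 0 -> x = 0.
Proof. by move=> x0; apply/val_inj/(ns_norm_eq0 (ns_valP x)). Qed.

HB.instance Definition _ :=
  @Lmodule_isNormed.Build R ns_type norm norm_D norm_Z norm_eq0.

Lemma ns_type_normE (x : ns_type) : `|x| = ns_norm X (ns_val x).
Proof. by []. Qed.

End ns_type.

Record banach_function_space (R : realType) (I : volterra_domain) :=
    BanachFunctionSpace {
  bfs_space :> normed_subspace (L0 (lebesgue_on R I));
  bfs_complete : forall F : set_system (ns_type bfs_space),
    ProperFilter F -> cauchy F -> cvg F;
  bfs_ideal : forall f g : L0 (lebesgue_on R I),
    (\forall x \ae lebesgue_on R I, `|f x| <= `|g x|) -> g \in bfs_space ->
    f \in bfs_space /\ ns_norm bfs_space f <= ns_norm bfs_space g;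
  bfs_positive : exists2 f : L0 (lebesgue_on R I), f \in bfs_space &
    \forall x \ae lebesgue_on R I, 0 < f x
}.

Section integral_norm.
Context d (T : measurableType d) (R : realType)
  (mu : {measure set T -> \bar R}) (D : set T) (mD : measurable D).
Implicit Types f g h : T -> R.

Lemma ae_le_integral_norm f g h (a : R) : 0 <= a ->
  measurable_fun setT f -> measurable_fun setT g -> measurable_fun setT h ->
  (\forall t \ae mu, D t -> `|h t| <= a * `|f t| + `|g t|) ->
  (\int[mu]_(t in D) (`|h t|%R)%:E <=
   a%:E * \int[mu]_(t in D) (`|f t|%R)%:E + \int[mu]_(t in D) (`|g t|%R)%:E)%E.
Proof.
move=> a0 mf mg mh hfg.
have mabs (k : T -> R) : measurable_fun setT k ->
    measurable_fun D (fun t => (`|k t|%R)%:E).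
  move=> mk; apply/measurable_EFinP; apply: measurable_funTS.
  exact: measurableT_comp.
have ma := mabs _ mf; have mb := mabs _ mg; have mc := mabs _ mh.
have maf : measurable_fun D (fun t => a%:E * (`|f t|%R)%:E)%E.
  exact: measurable_funeM.
rewrite -ge0_integralZl_EFin// -ge0_integralD//; last first.
  by move=> t _; rewrite mule_ge0// lee_fin.
apply: ae_ge0_le_integral => //.
- by move=> t _; rewrite adde_ge0// ?mule_ge0// lee_fin.
- exact: emeasurable_funD.
Qed.

Lemma integral_norm_eq0P f : measurable_fun setT f ->
  (\int[mu]_(t in D) (`|f t|%R)%:E = 0)%E <->
  (\forall t \ae mu, D t -> f t = 0).
Proof.
move=> mf; have mf' : measurable_fun D (EFin \o f).
  exact/measurable_EFinP/measurable_funTS.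
have := ae_eq_integral_abs mu mD mf'; rewrite /ae_eq /= => -[h1 h2].
split=> [/h1|f0]; first by apply: filterS => t /[apply] -[].
by apply: h2; apply: filterS f0 => t /[apply] ->.
Qed.

End integral_norm.

Section volterra.
Variables (R : realType) (I : volterra_domain).
Implicit Types f g h : L0 (lebesgue_on R I).

(* Extended-real valued, because the integral of |f| over [0, x] may diverge. *)
Definition volterra (f : lebesgue_line R -> R) (x : lebesgue_line R) : \bar R :=
  (\int[lebesgue R]_(t in `[0%R : R, x : R]) (f t)%:E)%E.

Definition volterra_abs f (x : lebesgue_line R) : \bar R :=
  volterra (fun t => `|f t|) x.

Let mitv (x : R) : measurable (`[0%R : R, x] : set (lebesgue_line R)).
Proof. by apply: borel_measurable_lebesgue; exact: measurable_itv. Qed.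

Let mabs f (D : set (lebesgue_line R)) :
  measurable_fun D (fun t => (`|f t|)%:E).
Proof.
apply/measurable_EFinP; apply: measurable_funTS.
by apply: measurableT_comp => //; exact: L0_measurable.
Qed.

Lemma volterra_abs_ge0 f x : (0 <= volterra_abs f x)%E.
Proof. by apply: integral_ge0 => t _; rewrite lee_fin. Qed.

Lemma le_volterra_abs f (x y : R) :
  x <= y -> (volterra_abs f x <= volterra_abs f y)%E.
Proof.
move=> xy; apply: ge0_subset_integral => //.
by apply: subset_itvl; rewrite bnd_simp.
Qed.

Lemma measurable_volterra_abs f : measurable_fun setT (volterra_abs f).
Proof.
apply: (measurability _ (ErealGenOInfty.measurableE R)) => _ [_ [r ->] <-].
rewrite setTI; apply: borel_measurable_lebesgue; apply: is_interval_measurable.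
move=> s t /=; rewrite !in_itv/= !andbT => rs _ u /andP[su _].
by rewrite in_itv/= andbT (lt_le_trans rs)// le_volterra_abs.
Qed.

Lemma measurable_fine_volterra_abs f :
  measurable_fun setT (fine \o volterra_abs f).
Proof. exact: measurableT_comp (measurable_volterra_abs f). Qed.

(* The class of V|f| in L^0(I), relevant only when V|f| is finite a.e. on I. *)
Definition L0_volterra_abs f : L0 (lebesgue_on R I) :=
  L0_class (lebesgue_on R I) (measurable_fine_volterra_abs f).

Lemma L0_volterra_absE f :
  \forall x \ae lebesgue_on R I, L0_volterra_abs f x = fine (volterra_abs f x).
Proof. exact: L0_classK. Qed.

Lemma itv_sub_domain (x : lebesgue_line R) :
  domain_set R I x -> `[0%R : R, x : R] `<=` domain_set R I.
Proof.
rewrite /domain_set; case: I => /=; rewrite in_itv/= => /andP[x0 x1] t /=;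
  rewrite !in_itv/= => /andP[t0 tx]; rewrite t0 ?andbT//=.
exact: le_trans tx x1.
Qed.

Lemma volterra_abs_le f g h (a : R) (x : lebesgue_line R) : 0 <= a ->
  (\forall t \ae lebesgue_on R I, `|h t| <= a * `|f t| + `|g t|) ->
  domain_set R I x ->
  (volterra_abs h x <= a%:E * volterra_abs f x + volterra_abs g x)%E.
Proof.
move=> a0 /ae_lebesgue_onP hfg Ix.
apply: ae_le_integral_norm => //; try exact: L0_measurable.
by apply: filterS hfg => t + xt; apply; exact: itv_sub_domain xt.
Qed.

End volterra.

Section volterra_space.
Variables (R : realType) (I : volterra_domain) (X : banach_function_space R I).
Local Notation mu := (lebesgue_on R I).
Implicit Types f g h : L0 mu.

(* V|f| belongs to X: it has to be finite a.e. (it may be infinite at the right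
   endpoint of [0, 1]) and its class has to lie in X. *)
Definition volterra_carrier : {pred L0 mu} :=
  mem [set f : L0 mu | (\forall x \ae mu, volterra_abs f x < +oo)%E /\
                       L0_volterra_abs f \in (X : {pred L0 mu})].

Definition volterra_norm f : R := ns_norm X (L0_volterra_abs f).

Let inV f : reflect ((\forall x \ae mu, volterra_abs f x < +oo)%E /\
  L0_volterra_abs f \in (X : {pred L0 mu})) (f \in volterra_carrier).
Proof. by apply: (iffP idP) => [/set_mem|/mem_set]. Qed.

Let ae_domain : \forall x \ae mu, domain_set R I x.
Proof. by apply/ae_lebesgue_onP; apply: aeW. Qed.

Let X0 : 0 \in (X : {pred L0 mu}).
Proof. by have [] := ns_submod_closed X. Qed.

Let norm0 : ns_norm X 0 = 0.
Proof. by rewrite -(scale0r 0) ns_normZ// normr0 mul0r. Qed.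

Let volterra_abs0 x : domain_set R I x -> volterra_abs (0 : L0 mu) x = 0%E.
Proof.
move=> Ix; have mitv : measurable (`[0%R : R, x : R] : set (lebesgue_line R)).
  by apply: borel_measurable_lebesgue; exact: measurable_itv.
apply/integral_norm_eq0P => //; try exact: L0_measurable.
have /ae_lebesgue_onP := L0_zeroE mu.
by apply: filterS => t + xt; apply; exact: itv_sub_domain xt.
Qed.

Let V_abs0 : L0_volterra_abs (0 : L0 mu) = 0.
Proof.
apply/L0_eqP; apply: filterS3 (L0_volterra_absE (0 : L0 mu)) (L0_zeroE mu) ae_domain.
by move=> x -> -> /volterra_abs0 ->.
Qed.

Let V0 : 0 \in volterra_carrier.
Proof.
apply/inV; split; last by rewrite V_abs0.
by apply: filterS ae_domain => x /volterra_abs0 ->; rewrite ltry.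
Qed.

Let V_le f g h (a : R) : 0 <= a ->
    f \in volterra_carrier -> g \in volterra_carrier ->
    (\forall t \ae mu, `|h t| <= a * `|f t| + `|g t|) ->
  h \in volterra_carrier /\
  volterra_norm h <= a * volterra_norm f + volterra_norm g.
Proof.
move=> a0 /inV[foo fX] /inV[goo gX] hfg.
have hle : \forall x \ae mu,
    (volterra_abs h x <= a%:E * volterra_abs f x + volterra_abs g x)%E.
  by apply: filterS ae_domain => x; exact: volterra_abs_le.
have hoo : \forall x \ae mu, (volterra_abs h x < +oo)%E.
  apply: filterS3 hle foo goo => x /le_lt_trans + fx gx; apply.
  by rewrite lte_add_pinfty// lte_mul_pinfty// lee_fin.
have [_ Xlin] := ns_submod_closed X.
have [hX hN] : L0_volterra_abs h \in (X : {pred L0 mu}) /\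
    ns_norm X (L0_volterra_abs h) <=
    ns_norm X (a *: L0_volterra_abs f + L0_volterra_abs g).
  apply: bfs_ideal; last exact: Xlin.
  apply: filterS3 (L0_volterra_absE h) (filterI (L0_volterra_absE f) (L0_volterra_absE g))
    (filterI (filterI (L0_addE (a *: L0_volterra_abs f) (L0_volterra_abs g))
       (L0_scaleE a (L0_volterra_abs f))) (filterI hle (filterI foo goo))).
  move=> x -> [fE gE] [[-> ->] [hx [fx gx]]]; rewrite fE gE.
  have ffin : volterra_abs f x \is a fin_num.
    by rewrite ge0_fin_numE// volterra_abs_ge0.
  have gfin : volterra_abs g x \is a fin_num.
    by rewrite ge0_fin_numE// volterra_abs_ge0.
  have h0 : 0 <= fine (volterra_abs h x) by rewrite fine_ge0// volterra_abs_ge0.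
  rewrite !ger0_norm//; last first.
    by rewrite addr_ge0// ?mulr_ge0// fine_ge0// volterra_abs_ge0.
  have hfin : volterra_abs h x \is a fin_num.
    rewrite ge0_fin_numE ?volterra_abs_ge0//; apply: le_lt_trans hx _.
    by rewrite -(fineK ffin) -(fineK gfin) -EFinM -EFinD ltry.
  by rewrite -lee_fin EFinD EFinM !fineK.
split; first exact/inV.
rewrite /volterra_norm (le_trans hN)//.
have afX : a *: L0_volterra_abs f \in (X : {pred L0 mu}).
  by rewrite -[_ *: _]addr0; exact: Xlin.
by rewrite (le_trans (ns_normD afX gX))// ns_normZ// (ger0_norm a0).
Qed.

Let volterra_submod_closed : submod_closed volterra_carrier.
Proof.
split=> // a f g fV gV.
have [] // := @V_le f g (a *: f + g) `|a| (normr_ge0 a) fV gV.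
apply: filterS2 (L0_addE (a *: f) g) (L0_scaleE a f) => x -> ->.
by rewrite -normrM ler_normD.
Qed.

Let volterra_normD : {in volterra_carrier &, forall f g,
  volterra_norm (f + g) <= volterra_norm f + volterra_norm g}.
Proof.
move=> f g fV gV; rewrite -[volterra_norm f]mul1r.
have [] // := @V_le f g (f + g) 1 ler01 fV gV.
by apply: filterS (L0_addE f g) => x ->; rewrite mul1r ler_normD.
Qed.

Let normV0 : volterra_norm 0 = 0.
Proof. by rewrite /volterra_norm V_abs0. Qed.

Let volterra_normZ_le (a : R) : {in volterra_carrier, forall f,
  a *: f \in volterra_carrier /\
  volterra_norm (a *: f) <= `|a| * volterra_norm f}.
Proof.
move=> f fV; rewrite -[X in _ <= X]addr0 -normV0.
apply: V_le => //.
apply: filterS (L0_scaleE a f) => x ->.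
by rewrite normrM lerDl.
Qed.

Let volterra_normZ (a : R) : {in volterra_carrier, forall f,
  volterra_norm (a *: f) = `|a| * volterra_norm f}.
Proof.
move=> f fV; have [->|a0] := eqVneq a 0.
  by rewrite scale0r normr0 mul0r.
have [afV afN] := volterra_normZ_le a fV.
apply/eqP; rewrite eq_le afN/=.
have [_] := volterra_normZ_le a^-1 afV.
rewrite scalerA mulVf// scale1r normfV.
by rewrite ler_pdivlMl ?normr_gt0.
Qed.

Let volterra_norm_eq0 : {in volterra_carrier, forall f,
  volterra_norm f = 0 -> f = 0}.
Proof.
move=> f /inV[foo fX] /(ns_norm_eq0 fX)/L0_eqP f0.
have {f0} : \forall x \ae mu, volterra_abs f x = 0%E.
  apply: filterS3 (filterI f0 foo) (L0_volterra_absE f) (L0_zeroE mu).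
  move=> x [fE fx] VE z0; move: VE; rewrite fE z0 => /esym/eqP.
  rewrite fine_eq0; first by move/eqP.
  by rewrite ge0_fin_numE// volterra_abs_ge0.
move=> [N [mN N0 VN]].
have pos (a b : R) : a < b -> `[a, b] `<=` domain_set R I ->
    exists2 x : R, a <= x <= b & volterra_abs f x = 0%E.
  move=> ab abI; apply: contrapT => nx.
  suff : lebesgue R (`[a, b]%classic : set R) = 0%E.
    rewrite [LHS](_ : _ = lebesgue_measure (`[a, b]%classic : set R))//.
    rewrite lebesgue_measure_itv/= lte_fin ab -EFinB => -[] /eqP.
    by rewrite subr_eq0 gt_eqF.
  have N0' : lebesgue R (N `&` domain_set R I) = 0%E by exact: N0.
  apply: (subset_measure0 _ _ _ N0').
  - by apply: borel_measurable_lebesgue; exact: measurable_itv.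
  - by apply: measurableI => //; exact: measurable_domain.
  - move=> x /= xab; split; last exact: abI.
    by apply: VN => /= Vx; apply: nx; exists x.
have Vz (x : R) : volterra_abs f x = 0%E ->
    \forall t \ae lebesgue R, 0 <= t <= x -> f t = 0.
  have mitv : measurable (`[0%R : R, x : R] : set (lebesgue_line R)).
    by apply: borel_measurable_lebesgue; exact: measurable_itv.
  move=> Vx.
  have /(integral_norm_eq0P _ mitv (L0_measurable f)) := Vx.
  by apply: filterS => t /= + tx; rewrite in_itv/= tx; exact.
have [x_ x_0 x_cover] : exists2 x_ : nat -> R,
    (forall n, volterra_abs f (x_ n) = 0%E) &
    \forall t \ae lebesgue R, domain_set R I t -> exists n, 0 <= t <= x_ n.
  case: (domain_setE R I) => IE; rewrite IE in pos *.
  - have {}pos n : exists x : R,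
        1 - n.+1%:R^-1 <= x /\ volterra_abs f x = 0%E.
      have [||x /andP[x1 x2] Vx] := pos (1 - n.+1%:R^-1) 1.
      + by rewrite gtrBl invr_gt0 ltr0n.
      + move=> t; rewrite /= !in_itv/= => /andP[tn ->]; rewrite andbT.
        by rewrite (le_trans _ tn)// subr_ge0 invf_le1 ?ltr0n// ler1n.
      + by exists x.
    have [x_ x_P] := choice pos.
    exists x_ => [n|]; first by have [] := x_P n.
    exists ([set (1 : R)] : set (lebesgue_line R)); split.
    + by apply: borel_measurable_lebesgue; exact: measurable_set1.
    + exact: lebesgue_measure_set1.
    + move=> t /= /not_implyP[]; rewrite in_itv/= => /andP[t0 t1] nt.
      apply/eqP; rewrite eq_le t1/= leNgt; apply/negP => lt1; apply: nt.
      have t1' : 0 < (1 : R) - t by rewrite subr_gt0.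
      have [k _ /(_ k (leqnn k)) /= kt] := near_infty_natSinv_lt (PosNum t1').
      exists k; rewrite t0/= (le_trans _ (x_P k).1)//.
      by rewrite lerBrDr addrC -lerBrDr ltW.
  - have {}pos n : exists x : R, n%:R <= x /\ volterra_abs f x = 0%E.
      have [||x /andP[x1 x2] Vx] := pos n%:R n.+1%:R.
      + by rewrite ltr_nat.
      + move=> t; rewrite /= !in_itv/= => /andP[tn _]; rewrite andbT.
        by rewrite (le_trans _ tn).
      + by exists x.
    have [x_ x_P] := choice pos.
    exists x_ => [n|]; first by have [] := x_P n.
    apply: aeW => t; rewrite /= in_itv/= andbT => t0.
    exists (Num.truncn t).+1; rewrite t0/= (le_trans _ (x_P _).1)//.
    by rewrite ltW// truncnS_gt.
apply/L0_eqP.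
have := ae_foralln (fun n => Vz _ (x_0 n)) => fz.
have : \forall x \ae mu, f x = 0.
  apply/ae_lebesgue_onP; apply: filterS2 fz x_cover => t ft /[apply] -[n].
  exact: ft.
by move=> fz'; apply: filterS2 fz' (L0_zeroE mu) => x -> ->.
Qed.

Definition volterra_space : normed_subspace (L0 mu) :=
  NormedSubspace volterra_submod_closed volterra_normD volterra_normZ
    volterra_norm_eq0.

End volterra_space.

(* alpha ranges over l^1; convergence in E of the vector-valued series is part
   of the requirement, since limn is an arbitrary value otherwise. *)
Definition contains_ai_l1 (R : realType) (E : normedModType R) :=
  exists (x : nat -> E) (eps : nat -> R),
    [/\ forall n, 0 < eps n < 1,
        eps n @[n --> \oo] --> 0 &
        forall alpha : nat -> R, cvgn [normed series alpha] ->
          let s := limn (series (fun n => alpha n *: x n)) in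
          [/\ cvgn (series (fun n => alpha n *: x n)),
              limn (series (fun n => (1 - eps n) * `|alpha n|)) <= `|s| &
              `|s| <= limn (series (fun n => `|alpha n|))]].

Definition fixed_point_property (R : realType) (E : normedModType R) :=
  forall K : set E, K !=set0 -> closed K -> bounded_set K -> convex_set K ->
  forall S : E -> E, (forall x, K x -> K (S x)) ->
    (forall x y, K x -> K y -> `|S x - S y| <= `|x - y|) ->
    exists2 x, K x & S x = x.

(* Main.v *)
Require Import Defs.
From mathcomp Require Import all_boot all_order all_algebra.
From mathcomp Require Import all_classical all_reals all_analysis.
From mathcomp Require Import measurable_realfun ring lra.

(** The idea.  Normalised indicators y_0, y_1, ... of sets that lie one after
    the other on the line have Volterra transforms V y_n that climb from 0 to 1
    between c_n and c_(n+1).  If the c_n increase, then V y_0 >= V y_1 >= ...,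
    the norms of the y_n in VX decrease, and for coefficients a_0, ..., a_(N-1)
<<
      V |sum a_n y_n| = sum |a_n| V y_n >= (sum |a_n|) V y_N ,
>>
    because the y_n are disjointly supported.  So the norm of sum a_n y_n is at
    least (sum |a_n|) |y_N|, whereas the triangle inequality bounds it by
    sum |a_n| |y_n|.  Both estimates involve norms that decrease to the same
    limit L, and L > 0 because every V y_n is 1 to the right of all the c_n.
    After normalisation the two estimates differ by the factors L / |y_n|, which
    tend to 1: this is an asymptotically isometric copy of l^1
    (dominating_ai_l1).

    The sets exist when VX is not trivial: a nonzero f has a superlevel set
    {1 <= k |f|} of positive measure inside some [0, b] that leaves room in I to
    the right of b (nonzero_superlevel), and such a set is cut by a bounded
    increasing sequence of points into infinitely many pieces of positive
    measure (exists_slicing).  The ideal property of X puts the indicators of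
    the pieces in VX.  Completeness of VX is avoided: the domination
    V y_n <= V y_0 makes every absolutely summable combination of the y_n
    converge in VX to its pointwise sum (cvg_basis_vec).

    The failure of the fixed point property is the argument of Dowling and
    Lennard.  Given an asymptotically isometric l^1 basis x_n whose defects
    tend to 0 fast enough, put w_n = (1 + 2^-n) x_n.  The shift w_n |-> w_(n+1)
    shrinks the weight of x_n by at least its defect, so it is nonexpansive on
    the absolutely summable combinations (fast_ai_l1_fails_fpp).  It maps the
    set of infinite convex combinations of the w_n, which is closed, bounded and
    convex, into itself, and has no fixed point there since a constant sequence
    does not sum to 1 (shift_fails_fpp). *)

Set Implicit Arguments.
Unset Strict Implicit.
Unset Printing Implicit Defensive.

Import Order.TTheory GRing.Theory Num.Theory.
Import numFieldNormedType.Exports.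
Local Open Scope classical_set_scope.
Local Open Scope ring_scope.

(** * Summable sequences of reals *)

Lemma cvg_sum_nat {R : realType} {T : Type} {F : set_system T} {FF : Filter F}
    (f : nat -> T -> R) (l : nat -> R) N :
  (forall n, f n @ F --> l n) ->
  (fun x => \sum_(0 <= n < N) f n x) @ F --> \sum_(0 <= n < N) l n.
Proof.
by move=> fl; apply: (cvg_big add_continuous) => n _; exact: fl.
Qed.

Section ell1.
Context {R : realType}.
Implicit Types a b : nat -> R.

Definition ell1 a := cvgn [normed series a].
Definition ell1_norm a : R := limn [normed series a].

Lemma nondecreasing_normed_series a : nondecreasing_seq [normed series a].
Proof. exact: (@nondecreasing_series R (fun n => `|a n|) predT 0). Qed.

Lemma ell1_bound a (M : R) : (forall N, \sum_(0 <= n < N) `|a n| <= M) ->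
  ell1 a /\ ell1_norm a <= M.
Proof.
move=> aM; have ca : ell1 a.
  apply: nondecreasing_is_cvgn; first exact: nondecreasing_normed_series.
  by exists M => _ [n _ <-]; exact: aM.
by split=> //; apply: limr_le => //; exact: nearW.
Qed.

Lemma ell1_finite a N : (forall n, (N <= n)%N -> a n = 0) -> ell1 a.
Proof.
move=> aN; apply/cvg_ex; exists (\sum_(0 <= n < N) `|a n|).
apply: cvg_near_cst; exists N => // m /= Nm.
rewrite /series/= (big_cat_nat (leq0n _) Nm)/= [X in _ + X]big_nat.
rewrite [X in _ + X]big1 ?addr0//.
by move=> n /andP[/aN-> _]; rewrite normr0.
Qed.

Lemma sum_le_ell1_norm a N : ell1 a -> \sum_(0 <= n < N) `|a n| <= ell1_norm a.
Proof.
by move/(nondecreasing_cvgn_le (nondecreasing_normed_series a)); exact.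
Qed.

Lemma term_le_ell1_norm a n : ell1 a -> `|a n| <= ell1_norm a.
Proof.
move=> /(sum_le_ell1_norm n.+1); apply: le_trans.
by rewrite big_nat_recr//= lerDr sumr_ge0.
Qed.

Lemma ell1_norm_ge0 a : ell1 a -> 0 <= ell1_norm a.
Proof. by move=> /(term_le_ell1_norm 0%N); exact: le_trans. Qed.

Lemma ell1_dominated a b (c : R) : ell1 a -> 0 <= c ->
  (forall n, `|b n| <= c * `|a n|) -> ell1 b /\ ell1_norm b <= c * ell1_norm a.
Proof.
move=> la c0 ba; apply: ell1_bound => N.
apply: (@le_trans _ _ (\sum_(0 <= n < N) c * `|a n|)); first exact: ler_sum.
by rewrite -mulr_sumr ler_wpM2l// sum_le_ell1_norm.
Qed.

Lemma ell1_comb (c d : R) a b : ell1 a -> ell1 b ->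
  ell1 (fun n => c * a n + d * b n).
Proof.
move=> la lb.
have [] // := @ell1_bound (fun n => c * a n + d * b n)
  (`|c| * ell1_norm a + `|d| * ell1_norm b).
move=> N.
apply: (@le_trans _ _ (\sum_(0 <= n < N) (`|c| * `|a n| + `|d| * `|b n|))).
  by apply: ler_sum => n _; rewrite -!normrM ler_normD.
by rewrite big_split/= -!mulr_sumr lerD// ler_wpM2l// sum_le_ell1_norm.
Qed.

Lemma ell1B {a b} : ell1 a -> ell1 b -> ell1 (fun n => a n - b n).
Proof.
move=> la lb; have := ell1_comb (c := 1) (d := -1) la lb.
by under eq_fun do rewrite mul1r mulN1r.
Qed.

Lemma ell1_tail_cvg0 a : ell1 a ->
  (fun N => ell1_norm (fun n => a n - (if (n < N)%N then a n else 0)))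
    @ \oo --> 0.
Proof.
move=> la; apply: (@squeeze_cvgr _ _ _ _ (fun=> 0)
    (fun N => ell1_norm a - \sum_(0 <= n < N) `|a n|)).
- apply: nearW => N.
  have [|lt ->] := @ell1_bound (fun n => a n - (if (n < N)%N then a n else 0))
      (ell1_norm a - \sum_(0 <= n < N) `|a n|); last first.
    by rewrite ell1_norm_ge0.
  move=> M; rewrite lerBrDr; apply: le_trans (sum_le_ell1_norm (N + M) la).
  rewrite [leRHS](big_cat_nat (leq0n _) (leq_addr M N))/= [leLHS]addrC lerD2l.
  have [MN|/ltnW NM] := leqP M N.
    rewrite big_nat big1 ?sumr_ge0// => n /andP[_ nM].
    by rewrite (leq_trans nM MN) subrr normr0.
  rewrite (big_cat_nat (leq0n _) NM)/= [X in X + _]big_nat.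
  rewrite [X in X + _]big1 ?add0r; last first.
    by move=> n /andP[_ ->]; rewrite subrr normr0.
  rewrite [leRHS](big_cat_nat NM (leq_addl N M))/= big_nat.
  rewrite [X in _ <= X + _]big_nat.
  rewrite -[leLHS]addr0 lerD ?sumr_ge0//; apply: ler_sum => n /andP[Nn _].
  by rewrite ltnNge Nn subr0.
- exact: cvg_cst.
- have cs : (fun N => \sum_(0 <= n < N) `|a n|) @ \oo --> ell1_norm a.
    exact: la.
  rewrite -[X in _ --> X](subrr (ell1_norm a)).
  by apply: cvgB cs; exact: cvg_cst.
Qed.

Definition right_shift {V : zmodType} (u : nat -> V) n :=
  if n is m.+1 then u m else 0.

Lemma series_right_shift {V : zmodType} (u : nat -> V) N :
  series (right_shift u) N.+1 = series u N.
Proof. by rewrite /series/= big_nat_recl//= add0r. Qed.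

Lemma ell1_right_shift a : ell1 a -> ell1 (right_shift a).
Proof.
move=> la; have [] // := @ell1_bound (right_shift a) (ell1_norm a).
case=> [|N]; first by rewrite big_geq// ell1_norm_ge0.
by rewrite big_nat_recl//= normr0 add0r sum_le_ell1_norm.
Qed.

(** Completeness of l^1 with its rate.  The limit is coordinatewise; the bounds
    survive because a partial sum of the norm sees finitely many coordinates. *)
Lemma ell1_complete (u : nat -> nat -> R) (r : nat -> R) :
    (forall j, ell1 (u j)) -> r @ \oo --> 0 ->
    (forall i j, (j <= i)%N -> ell1_norm (fun n => u j n - u i n) <= r j) ->
  exists2 a, ell1 a & forall j, ell1_norm (fun n => u j n - a n) <= r j.
Proof.
move=> lu r0 ur.
have uc n : cvgn (u ^~ n).
  apply/cauchy_cvgP/cauchy_exP => e e0.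
  have [j _ rj] := (cvgrPdist_lt _ _).1 r0 e e0.
  exists (u j n); exists j => // i /= ji.
  apply: le_lt_trans (term_le_ell1_norm n (ell1B (lu j) (lu i))) _.
  apply: le_lt_trans (ur _ _ ji) _.
  have := rj j (leqnn j).
  by rewrite /= sub0r normrN; apply: le_lt_trans; exact: ler_norm.
pose a n := limn (u ^~ n).
have ua j : ell1 (fun n => u j n - a n) /\
    ell1_norm (fun n => u j n - a n) <= r j.
  apply: ell1_bound => N.
  have : (fun i => \sum_(0 <= n < N) `|u j n - u i n|) @ \oo -->
      \sum_(0 <= n < N) `|u j n - a n|.
    apply: cvg_sum_nat => n.
    by apply: cvg_norm; apply: cvgB; [exact: cvg_cst|exact: uc].
  move=> /cvgr_to_le; apply; exists j => // i /= ji.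
  by apply: le_trans (ur _ _ ji); apply: sum_le_ell1_norm; exact: ell1B.
exists a => [|j]; last exact: (ua j).2.
have := ell1B (lu 0%N) (ua 0%N).1.
by under eq_fun do rewrite opprB addrC subrK.
Qed.

End ell1.

Lemma cvg_series_right_shift {R : realType} {E : normedModType R}
    (u : nat -> E) (l : E) :
  series u @ \oo --> l -> series (right_shift u) @ \oo --> l.
Proof.
move=> ul; rewrite -cvg_shiftS.
by under eq_fun do rewrite series_right_shift.
Qed.

(** * Bases equivalent to the l^1 basis with a nonexpansive shift *)

Section fixed_point_free_shift.
Context {R : realType} {E : normedModType R} (w : nat -> E).
Implicit Types (a b t : nat -> R).

Definition ell1_map a : E := limn (series (fun n => a n *: w n)).

Hypothesis cvg_w : forall a, ell1 a -> cvgn (series (fun n => a n *: w n)).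

Lemma ell1_map_comb (c d : R) a b : ell1 a -> ell1 b ->
  ell1_map (fun n => c * a n + d * b n) = c *: ell1_map a + d *: ell1_map b.
Proof.
move=> la lb; apply/cvg_lim => //.
rewrite (_ : series _ = fun N => c *: series (fun n => a n *: w n) N +
   d *: series (fun n => b n *: w n) N).
  by apply: cvgD; apply: cvgZl_tmp; exact: cvg_w.
apply/funext => N; rewrite /series/= !scaler_sumr -big_split/=.
by apply: eq_bigr => n _; rewrite scalerDl !scalerA.
Qed.

Lemma ell1_mapB a b : ell1 a -> ell1 b ->
  ell1_map (fun n => a n - b n) = ell1_map a - ell1_map b.
Proof.
move=> la lb; have := ell1_map_comb 1 (-1) la lb.
by rewrite scale1r scaleN1r; under eq_fun do rewrite mul1r mulN1r.
Qed.

Definition simplex t := (forall n, 0 <= t n) /\ series t @ \oo --> (1 : R).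

Lemma simplex_ell1 t : simplex t -> ell1 t.
Proof.
move=> [t0 t1]; rewrite /ell1 ger0_normed//.
by apply/cvg_ex; exists 1.
Qed.

Lemma simplex_norm t : simplex t -> ell1_norm t = 1.
Proof. by move=> [t0 t1]; rewrite /ell1_norm ger0_normed//; exact: cvg_lim. Qed.

Lemma simplex_right_shift t : simplex t -> simplex (right_shift t).
Proof.
by move=> [t0 t1]; split; [case|exact: cvg_series_right_shift].
Qed.

(** A sequence equal to its shift starts with 0 and is constant. *)
Lemma simplex_right_shift_neq t : simplex t -> right_shift t <> t.
Proof.
move=> [_ t1] tt.
have t0 n : t n = 0 by elim: n => [|n ih]; rewrite -tt.
suff : (0 : R) = 1 by move/eqP; rewrite eq_sym oner_eq0.
rewrite -(cvg_lim _ t1)//; apply/esym/cvg_lim => //.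
rewrite (_ : series t = cst 0); first exact: cvg_cst.
by apply/funext => N; rewrite /series/= big1.
Qed.

Hypothesis w_lb : forall a, ell1 a -> ell1_norm a <= `|ell1_map a|.

Variable C : R.
Hypothesis w_ub : forall a, ell1 a -> `|ell1_map a| <= C * ell1_norm a.

(** Limits are found in l^1, not in E, which may be incomplete: by the lower
    bound, the coefficients of a convergent sequence of the image are Cauchy for
    the l^1 norm. *)
Lemma simplex_image_closed : closed [set ell1_map t | t in simplex].
Proof.
move=> z Kz.
have C0 : 0 <= C.
  have [_ [[t st <-] _]] := Kz setT filterT.
  have := w_ub (simplex_ell1 st); rewrite simplex_norm// mulr1.
  exact: le_trans.
have /choice[t tP] j : exists t, simplex t /\ `|z - ell1_map t| < j.+1%:R^-1.
  have [|_ [[t st <-]] zt] := Kz (ball z j.+1%:R^-1).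
    by apply: nbhsx_ballx; rewrite invr_gt0 ltr0n.
  by exists t; split=> //; move: zt; rewrite -ball_normE.
have lt j : ell1 (t j) by apply: simplex_ell1; exact: (tP j).1.
(* z is within 1/(j+1) of the j-th approximant, hence the factor 2 between two
   approximants. *)
have r0 : (fun j => 2 * j.+1%:R^-1 : R) @ \oo --> 0.
  rewrite -(mulr0 2); apply: cvgMr; exact: cvg_harmonic.
have [|a la ta] := ell1_complete lt r0.
  move=> i j ji; apply: (le_trans (w_lb (ell1B (lt j) (lt i)))).
  rewrite ell1_mapB// -[_ - _](subrKA z) (le_trans (ler_normD _ _))//.
  rewrite mulrC mulr_natr mulr2n lerD//.
    by rewrite distrC ltW// (tP j).2.
  rewrite (le_trans (ltW (tP i).2))// lef_pV2 ?posrE ?ltr0n//.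
  by rewrite ler_nat.
have small (x y : R) : 0 <= y -> (forall j, x <= y * j.+1%:R^-1) -> x <= 0.
  move=> y0 xy; apply: (@cvgr_to_ge _ \oo _ _ (fun j => y * j.+1%:R^-1)).
    by rewrite -(mulr0 y); apply: cvgMr; exact: cvg_harmonic.
  exact: nearW.
exists a; first split.
- move=> n; rewrite -oppr_le0; apply: (small _ 2) => // j.
  apply: le_trans (ta j).
  apply: le_trans (term_le_ell1_norm n (ell1B (lt j) la)).
  apply: le_trans (ler_norm _); rewrite lerDr; exact: (tP j).1.1.
- have sa : cvgn (series a) by exact: normed_cvg.
  suff : `|limn (series a) - 1| <= 0.
    by rewrite normr_le0 subr_eq0 => /eqP <-.
  apply: (small _ 2) => // j; apply: le_trans (ta j).
  have st : series (t j) @ \oo --> (1 : R) by exact: (tP j).1.2.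
  rewrite distrC -(cvg_lim _ st)// -lim_seriesB//; last by apply/cvg_ex; exists 1.
  exact/lim_series_norm/(ell1B (lt j) la).
- apply/eqP; rewrite -subr_eq0 -normr_le0 distrC.
  apply: (small _ (1 + C * 2)) => [|j]; first by rewrite addr_ge0// mulr_ge0.
  rewrite -(subrKA (ell1_map (t j))) (le_trans (ler_normD _ _))// mulrDl mul1r.
  rewrite lerD//; first by rewrite ltW// (tP j).2.
  rewrite -ell1_mapB// (le_trans (w_ub (ell1B (lt j) la)))// -mulrA.
  by rewrite ler_wpM2l.
Qed.

Hypothesis w_shift :
  forall a, ell1 a -> `|ell1_map (right_shift a)| <= `|ell1_map a|.

(** The map sends each point of the image of the simplex to the shift of a
    chosen coefficient sequence; a fixed point would give, by injectivity of
    [ell1_map], a sequence of the simplex equal to its shift. *)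
Lemma shift_fails_fpp : ~ fixed_point_property E.
Proof.
move=> fpp; pose K := [set ell1_map t | t in simplex].
have KS z : exists t, K z -> simplex t /\ ell1_map t = z.
  have [[t st tz]|nK] := pselect (K z); first by exists t.
  by exists (cst 0) => /nK.
have [coef coefP] := choice KS.
have K0 : K !=set0.
  pose e n : R := if n is 0%N then 1 else 0.
  exists (ell1_map e), e => //; split; first by case.
  rewrite -cvg_shiftS; apply: cvg_near_cst; apply: nearW => N /=.
  by rewrite /series/= big_nat_recl//= big1 ?addr0.
have bK : bounded_set K.
  exists C; split; first exact: num_real.
  move=> M CM _ [t st <-] /=; apply: le_trans (ltW CM).
  by have := w_ub (simplex_ell1 st); rewrite simplex_norm// mulr1.
have cK : convex_set K.
  move=> x y l /set_mem[s ss <-] /set_mem[t st <-]; apply/mem_set.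
  have [ls lt] := (simplex_ell1 ss, simplex_ell1 st).
  exists (fun n => l%:num * s n + (1 - l%:num) * t n); last exact: ell1_map_comb.
  split=> [n|].
    by rewrite addr_ge0// mulr_ge0 ?ss.1 ?st.1// subr_ge0.
  rewrite (_ : series _ = fun N => l%:num * series s N +
      (1 - l%:num) * series t N).
    rewrite [X in _ --> X](_ : _ = l%:num * 1 + (1 - l%:num) * 1).
      by apply: cvgD; apply: cvgMr; [exact: ss.2|exact: st.2].
    by rewrite !mulr1 subrKC.
  by apply/funext => N; rewrite /series/= !mulr_sumr -big_split.
have SK x : K x -> K (ell1_map (right_shift (coef x))).
  move=> /coefP[sx _].
  by exists (right_shift (coef x)) => //; exact: simplex_right_shift.
have right_shiftB a b :
    (fun n => right_shift a n - right_shift b n) =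
    right_shift (fun n => a n - b n) :> (nat -> R).
  by apply/funext => -[|n] //=; rewrite subrr.
have [|x Kx] := fpp K K0 simplex_image_closed bK cK _ SK.
- move=> x y /coefP[sx {2}<-] /coefP[sy {2}<-].
  have [lx ly] := (simplex_ell1 sx, simplex_ell1 sy).
  rewrite -!ell1_mapB//; try exact: ell1_right_shift.
  by rewrite right_shiftB; apply: w_shift; exact: ell1B.
have [sx {2}<-] := coefP x Kx.
have [lx lSx] := (simplex_ell1 sx, simplex_ell1 (simplex_right_shift sx)).
move=> /eqP; rewrite -subr_eq0 -normr_le0 -ell1_mapB// => xSx.
apply: (simplex_right_shift_neq sx); apply/funext => n; apply/eqP.
rewrite -subr_eq0 -normr_le0; apply: le_trans xSx.
by apply: le_trans (w_lb (ell1B lSx lx)); exact/term_le_ell1_norm/ell1B.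
Qed.

End fixed_point_free_shift.

(** * Passing to subsequences *)

Section subsequence.
Variable phi : nat -> nat.
Hypothesis phi_lt : {homo phi : m n / (m < n)%N}.

(** The coefficients [a] moved along [phi].  The sum has at most one term, and
    the range below [m.+1] suffices because [n <= phi n]. *)
Definition spread {V : nmodType} (a : nat -> V) m : V :=
  \sum_(n < m.+1 | phi n == m) a n.

Lemma subseq_index_ge n : (n <= phi n)%N.
Proof. by elim: n => // n ih; apply: leq_ltn_trans ih (phi_lt _). Qed.

Lemma subseq_index_inj : injective phi.
Proof.
by move=> m n mn; case: (ltngtP m n) => // /phi_lt; rewrite mn ltnn.
Qed.

Lemma spread_phi {V : nmodType} (a : nat -> V) n : spread a (phi n) = a n.
Proof.
have nP : (n < (phi n).+1)%N by rewrite ltnS subseq_index_ge.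
rewrite /spread (bigD1 (Ordinal nP))//= big1 ?addr0// => i.
move=> /andP[/eqP/subseq_index_inj ij].
by rewrite -val_eqE/= ij eqxx.
Qed.

Lemma spread_notin {V : nmodType} (a : nat -> V) m :
  (forall n, phi n != m) -> spread a m = 0.
Proof. by move=> nm; rewrite /spread big1// => i; rewrite (negPf (nm i)). Qed.

(** Stated for arbitrary terms [g] so as to serve for the vector series, for its
    l^1 norm and for the weighted norm of the lower estimate. *)
Lemma series_spread {U : nmodType} {V : zmodType} (g : nat -> U -> V)
    (a : nat -> U) N : (forall m, g m 0 = 0) ->
  series (fun m => g m (spread a m)) (phi N) =
  series (fun n => g (phi n) (a n)) N.
Proof.
move=> g0; rewrite /series/=; elim: N => [|N ih].
  rewrite [RHS]big_geq// big_nat big1// => m /andP[_ m0].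
  rewrite spread_notin// => n; rewrite gtn_eqF//.
  by apply: leq_trans m0 _; case: n => // n; exact/ltnW/phi_lt.
have NS : (phi N < phi N.+1)%N by exact: phi_lt.
rewrite (big_cat_nat (leq0n _) (ltnW NS))/= ih big_nat_recr//=; congr (_ + _).
rewrite big_ltn// spread_phi big_nat big1 ?addr0// => m /andP[Nm mN].
rewrite spread_notin// => n; have [nN|Nn] := leqP n N.
  rewrite ltn_eqF// (leq_ltn_trans _ Nm)//.
  by move: nN; rewrite leq_eqVlt => /predU1P[->//|/phi_lt/ltnW].
rewrite gtn_eqF// (leq_trans mN)//.
by move: Nn; rewrite leq_eqVlt => /predU1P[->//|/phi_lt/ltnW].
Qed.

End subsequence.

Lemma cvgn_subseq {T : ptopologicalType} (u v : nat -> T) (phi : nat -> nat) :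
  {homo phi : m n / (m < n)%N} -> (forall N, u (phi N) = v N) ->
  cvgn u -> v @ \oo --> limn u.
Proof.
move=> phi_lt uv cu.
have phioo : phi @ \oo --> \oo.
  apply/cvgnyPge => k; exists k => // n /= kn.
  exact: leq_trans kn (subseq_index_ge phi_lt n).
by have := cvg_comp _ _ phioo cu; rewrite (_ : u \o phi = v)//; apply/funext.
Qed.

Lemma fast_subsequence {R : realType} (eps delta : nat -> R) :
  eps @ \oo --> 0 -> (forall n, 0 < delta n) ->
  exists2 phi : nat -> nat, {homo phi : m n / (m < n)%N} &
    forall n, eps (phi n) <= delta n.
Proof.
move=> eps0 delta0.
have /choice[f fP] n : exists k, forall m, (k <= m)%N -> eps m <= delta n.
  have [k _ kP] := (cvgrPdist_le _ _).1 eps0 _ (delta0 n).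
  exists k => m km; have := kP m km.
  by rewrite /= sub0r normrN; apply: le_trans; exact: ler_norm.
exists (fun n => \sum_(0 <= k < n.+1) (f k).+1)%N.
  apply: homo_ltn => [? ? ?|n]; first exact: ltn_trans.
  by rewrite [ltnRHS]big_nat_recr//= -addn1 leq_add2l.
by move=> n; apply: fP; rewrite big_nat_recr//=; exact/ltnW/leq_addl.
Qed.

(** * Asymptotically isometric copies of l^1 *)

Section ai_l1_fails_fpp.
Context {R : realType} {E : normedModType R}.
Implicit Types (x : nat -> E) (eps : nat -> R).

Definition ai_l1_basis x eps :=
  (forall n, 0 < eps n < 1) /\
  forall a : nat -> R, ell1 a ->
    [/\ cvgn (series (fun n => a n *: x n)),
        limn (series (fun n => (1 - eps n) * `|a n|)) <= `|ell1_map x a| &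
        `|ell1_map x a| <= ell1_norm a].

Lemma cvg_ai_l1_lower eps a : (forall n, 0 < eps n < 1) -> ell1 a ->
  cvgn (series (fun n => (1 - eps n) * `|a n|)).
Proof.
move=> eps01 la; apply: normed_cvg.
have [] // := ell1_dominated (b := fun n => (1 - eps n) * `|a n|) la ler01.
move=> n; have /andP[e0 e1] := eps01 n.
by rewrite normrM normr_id ler_wpM2r// ger0_norm; lra.
Qed.

(** Let L be the limit of [`|y n|] and normalise: [x n = `|y n|^-1 *: y n].  The
    lower estimate loses the factor L / [`|y n|] on the n-th coefficient, and
    this tends to 1. *)
Lemma dominating_ai_l1 (y : nat -> E) (l : R) :
    0 < l -> (forall n, l <= `|y n|) -> nonincreasing_seq (fun n => `|y n|) ->
    (forall a N, (\sum_(0 <= n < N) `|a n|) * `|y N| <=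
                 `|\sum_(0 <= n < N) a n *: y n|) ->
    (forall a : nat -> R, ell1 a -> cvgn (series (fun n => a n *: y n))) ->
  contains_ai_l1 E.
Proof.
move=> l0 ly ydecr lower cy.
have cL : cvgn (fun n => `|y n|).
  by apply: nonincreasing_is_cvgn => //; exists l => _ [n _ <-].
pose L : R := limn (fun n => `|y n|).
have Ly n : L <= `|y n| by exact: (nonincreasing_cvgn_ge ydecr cL).
have L0 : 0 < L by apply: lt_le_trans l0 _; apply: limr_ge => //; exact: nearW.
have y0 n : 0 < `|y n| by exact: lt_le_trans (Ly n).
pose x n := `|y n|^-1 *: y n.
(* The factor 1 - 1/(n+2) keeps the defect positive if the norm of y n is
   already L. *)
pose eps n : R := 1 - L / `|y n| * (1 - n.+2%:R^-1).
have h0 n : 0 < n.+2%:R^-1 :> R by rewrite invr_gt0.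
have h1 n : n.+2%:R^-1 < 1 :> R by rewrite invf_lt1// ltr1n.
have q0 n : 0 < L / `|y n| by rewrite divr_gt0.
have q1 n : L / `|y n| <= 1 by rewrite ler_pdivrMr// mul1r.
have eps01 n : 0 < eps n < 1.
  have := h0 n; have := h1 n; have := q0 n; have := q1 n; rewrite /eps.
  by move: (L / _) (n.+2%:R^-1) => q h q1n q0n h1n h0n; apply/andP; split; nra.
exists x, eps; split=> // [|a la].
  rewrite /eps -[X in _ --> X](subrr 1); apply: cvgB; first exact: cvg_cst.
  rewrite -[X in _ --> X](mulr1 1); apply: cvgM.
    rewrite -[X in _ --> X](divff (lt0r_neq0 L0)); apply: cvgMr.
    by apply: cvgV => //; rewrite gt_eqF.
  rewrite -[X in _ --> X](subr0 1); apply: cvgB; first exact: cvg_cst.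
  by have := @cvg_harmonic R; rewrite -cvg_shiftS.
move=> s; pose c n := a n / `|y n|.
have lc : ell1 c.
  have [] // := ell1_dominated (b := c) (c := l^-1) la.
    by rewrite invr_ge0 ltW.
  move=> n; rewrite /c normrM normfV normr_id mulrC ler_wpM2r//.
  by rewrite lef_pV2 ?posrE.
have xE : (fun n => a n *: x n) = (fun n => c n *: y n).
  by apply/funext => n; rewrite scalerA.
have cs : series (fun n => a n *: x n) @ \oo --> s.
  by rewrite /s xE; exact: cy.
split; first by apply/cvg_ex; exists s.
- apply: (ler_cvg_to (cvg_ai_l1_lower eps01 la) (cvg_norm cs)).
  apply: nearW => N; rewrite xE; apply: le_trans (lower c N).
  rewrite mulr_suml; apply: ler_sum => n _.
  apply: (@le_trans _ _ (`|c n| * L)); last by rewrite ler_wpM2l.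
  rewrite /c normrM normfV normr_id.
  rewrite mulrAC -mulrA [leRHS]mulrC ler_wpM2r// /eps subKr.
  have := h0 n; have := h1 n; have := q0 n.
  by move: (L / _) (n.+2%:R^-1) => q h qn0 h1n h0n; nra.
- apply: (cvgr_to_le (cvg_norm cs)); apply: nearW => N.
  apply: le_trans (sum_le_ell1_norm N la); apply: le_trans (ler_norm_sum _ _ _) _.
  apply: ler_sum => n _; rewrite /x scalerA normrZ normrM normfV normr_id.
  by rewrite divfK ?gt_eqF.
Qed.

Lemma ai_l1_basis_subseq x eps (phi : nat -> nat) :
  {homo phi : m n / (m < n)%N} ->
  ai_l1_basis x eps -> ai_l1_basis (x \o phi) (eps \o phi).
Proof.
move=> phi_lt aix; split=> [n|a la]; first exact: aix.1.
set b := spread phi a.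
have sub (V : zmodType) (g : nat -> R -> V) :=
  @series_spread _ phi_lt _ _ g a.
have subn N : series (fun n => `|b n|) (phi N) = series (fun n => `|a n|) N.
  by apply: (sub _ (fun=> Num.norm)) => _; rewrite normr0.
have lb : ell1 b.
  have [] // := @ell1_bound _ b (ell1_norm a).
  move=> N; apply: le_trans (sum_le_ell1_norm N la).
  have := subn N; rewrite /series/= => <-.
  by apply: (@nondecreasing_normed_series _ b); exact: subseq_index_ge.
have [cb lo up] := aix.2 b lb.
have cx : series (fun n => a n *: x (phi n)) @ \oo --> ell1_map x b.
  apply: (cvgn_subseq phi_lt _ cb) => N.
  by apply: (sub _ (fun m c => c *: x m)) => m; rewrite scale0r.
have cl : series (fun n => (1 - eps (phi n)) * `|a n|) @ \oo -->
    limn (series (fun n => (1 - eps n) * `|b n|)).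
  apply: (cvgn_subseq phi_lt _ (cvg_ai_l1_lower aix.1 lb)) => N.
  by apply: (sub _ (fun m c => (1 - eps m) * `|c|)) => m; rewrite normr0 mulr0.
have cn : series (fun n => `|a n|) @ \oo --> ell1_norm b.
  exact: (cvgn_subseq phi_lt subn lb).
have -> : ell1_map (x \o phi) a = ell1_map x b by exact: cvg_lim cx.
have -> : ell1_norm a = ell1_norm b by exact: cvg_lim cn.
by split=> //; [apply/cvg_ex; exists (ell1_map x b)|rewrite (cvg_lim _ cl)].
Qed.

(** With the weights 1 + 2^-n, shifting a coefficient from n to n+1 multiplies
    its weight by a factor at most [1 - eps n], which is what the lower estimate
    loses on it; so the shift is nonexpansive. *)
Lemma fast_ai_l1_fails_fpp x eps : ai_l1_basis x eps ->
  (forall n, eps n <= 2^-1 ^+ n.+2) -> ~ fixed_point_property E.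
Proof.
move=> aix small.
pose lam n : R := 1 + 2^-1 ^+ n.
have h0 n : 0 < 2^-1 ^+ n :> R by rewrite exprn_gt0// invr_gt0.
have h1 n : 2^-1 ^+ n <= 1 :> R by rewrite exprn_ile1// invf_le1// ler1n.
have lam1 n : 1 <= lam n by rewrite lerDl ltW.
have lam2 n : lam n <= 2 by rewrite -[leRHS]/(1 + 1) lerD2l.
have lam_decr n : lam n.+1 <= (1 - eps n) * lam n.
  have := small n; have := h0 n; have := h1 n; have := lam1 n.
  by rewrite /lam !exprS; nra.
have [eps01 aix2] := aix.
pose w n := lam n *: x n.
have lam0 n : 0 <= lam n by exact: le_trans (lam1 n).
have llam a : ell1 a -> ell1 (fun n => lam n * a n) /\
    ell1_norm (fun n => lam n * a n) <= 2 * ell1_norm a.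
  move=> la; apply: ell1_dominated => // n.
  by rewrite normrM ler_wpM2r// ger0_norm.
have sw a : (fun n => a n *: w n) = (fun n => (lam n * a n) *: x n).
  by apply/funext => n; rewrite scalerA mulrC.
have mw a : ell1_map w a = ell1_map x (fun n => lam n * a n).
  by rewrite /ell1_map sw.
have lower a (b : nat -> R) : ell1 a -> (forall n, 0 <= b n) ->
    (forall n, b n <= (1 - eps n) * lam n * `|a n|) ->
    cvgn (series b) /\ limn (series b) <= `|ell1_map w a|.
  move=> la b0 ba; have [lla _] := llam a la.
  have [_ lo _] := aix2 _ lla.
  have ba' n : b n <= (1 - eps n) * `|lam n * a n|.
    by rewrite normrM (ger0_norm (lam0 n)) mulrA.
  have cl := cvg_ai_l1_lower eps01 lla.
  have cb : cvgn (series b).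
    by apply: (series_le_cvg b0 _ ba' cl) => n; exact: le_trans (ba' n).
  by split=> //; rewrite mw (le_trans _ lo)//; exact: lim_series_le.
apply: (@shift_fails_fpp _ _ w _ _ 2).
- by move=> a la; rewrite sw; have [] := aix2 _ (llam a la).1.
- move=> a la; have [//|n|//] := lower a (fun n => `|a n|) la.
  rewrite -[leLHS]mul1r ler_wpM2r//.
  exact: le_trans (lam1 n.+1) (lam_decr n).
- move=> a la; rewrite mw; have [lla lla2] := llam a la.
  by have [_ _ up] := aix2 _ lla; exact: le_trans lla2.
- move=> a la; rewrite {1}mw.
  have [lsa _] := llam _ (ell1_right_shift la).
  have [_ _ up] := aix2 _ lsa; apply: le_trans up _.
  have [|n|cb] := lower a (fun n => lam n.+1 * `|a n|) la.
  + by move=> n; rewrite mulr_ge0.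
  + by rewrite ler_wpM2r.
  apply: le_trans; rewrite le_eqVlt; apply/orP; left; apply/eqP.
  have shiftE : (fun n => `|lam n * right_shift a n|) =
      right_shift (fun n => lam n.+1 * `|a n|).
    apply/funext => -[|n] /=; first by rewrite mulr0 normr0.
    by rewrite normrM ger0_norm.
  have := cvg_series_right_shift cb; rewrite -shiftE => cs.
  exact: (cvg_lim _ cs).
Qed.

(** Dowling and Lennard: subsequences of an asymptotically isometric l^1 basis
    are again such bases, so the defects may be assumed to decay
    geometrically. *)
Lemma ai_l1_fails_fpp : contains_ai_l1 E -> ~ fixed_point_property E.
Proof.
move=> [x [eps [eps01 eps0 xP]]].
have aix : ai_l1_basis x eps by split.
have h0 n : 0 < 2^-1 ^+ n.+2 :> R by rewrite exprn_gt0// invr_gt0.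
have [phi phi_lt phiP] := fast_subsequence eps0 h0.
exact: fast_ai_l1_fails_fpp (ai_l1_basis_subseq phi_lt aix) phiP.
Qed.

End ai_l1_fails_fpp.

(** * Cutting a set into consecutive pieces of positive measure *)

Section lebesgue_splitting.
Context {R : realType}.
Local Notation leb := (lebesgue R).

Lemma lebesgue_itv (i : interval R) :
  leb ([set` i] : set R) = lebesgue_measure ([set` i] : set R).
Proof. by []. Qed.

Lemma measurable_itvL (i : interval R) :
  measurable ([set` i] : set (lebesgue_line R)).
Proof. by apply: borel_measurable_lebesgue; exact: measurable_itv. Qed.

(** The function G x = leb (A `&` ]-oo, x]) is 1-Lipschitz, so it takes the
    increasing values G b (1 - 1 / (n + 1)) by the intermediate value theorem;
    its increments are the measures of the pieces. *)
Lemma exists_slicing (A : set (lebesgue_line R)) (b : R) : measurable A ->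
  A `<=` `[0%R, b]%classic -> (0 < leb A)%E ->
  exists c : nat -> R, [/\ forall n, c n < c n.+1, forall n, c n <= b &
    forall n, (0 < leb (A `&` `]c n, c n.+1]%classic))%E].
Proof.
move=> mA Ab A0.
have b0 : 0 <= b.
  rewrite leNgt; apply/negP => b0.
  have A_0 : A = set0.
    apply/seteqP; split=> // t /Ab; rewrite /= in_itv/= => /andP[t0].
    by move=> /(le_trans t0); rewrite leNgt b0.
  by move: A0; rewrite A_0 measure0 ltxx.
have fin (D : set (lebesgue_line R)) : measurable D -> leb (A `&` D) \is a fin_num.
  move=> mD; rewrite ge0_fin_numE//.
  apply: (@le_lt_trans _ _ (leb (`[0%R, b]%classic : set R))).
    apply: le_measure; rewrite ?inE; [exact: measurableI|exact: measurable_itvL|].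
    by move=> t [/Ab].
  by rewrite lebesgue_itv lebesgue_measure_itv/= lte_fin; case: ifP => _; rewrite ltry.
pose G (x : R) : R := fine (leb (A `&` `]-oo, x]%classic)).
have GB x y : x <= y -> (G y - G x)%:E = leb (A `&` `]x, y]%classic).
  move=> xy; rewrite EFinB !fineK; try exact/fin/measurable_itvL.
  rewrite (_ : A `&` `]-oo, y]%classic =
      (A `&` `]-oo, x]%classic) `|` (A `&` `]x, y]%classic)); last first.
    by rewrite -setIUr -itv_bndbnd_setU// bnd_simp.
  rewrite measureU; try by apply: measurableI => //; exact: measurable_itvL.
    by rewrite addeAC subee ?add0e//; exact/fin/measurable_itvL.
  apply/seteqP; split=> // t [[_ /=]]; rewrite in_itv/= => tx [_].
  by rewrite /= in_itv/= ltNge tx.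
have G_mono x y : x <= y -> G x <= G y.
  by move=> xy; rewrite -subr_ge0 -lee_fin GB.
have G_lip x y : x <= y -> G y - G x <= y - x.
  move=> xy; rewrite -lee_fin GB//.
  apply: (@le_trans _ _ (leb (`]x, y]%classic : set R))).
    apply: le_measure; rewrite ?inE; [apply: measurableI => //| |].
    - exact: measurable_itvL.
    - exact: measurable_itvL.
    - by move=> t [].
  rewrite lebesgue_itv lebesgue_measure_itv/= lte_fin.
  by case: ifP => _ //; rewrite lee_fin subr_ge0.
have G_dist x y : `|G x - G y| <= `|x - y|.
  wlog xy : x y / x <= y.
    by move=> h; have [/h//|/ltW/h] := leP x y; rewrite distrC (distrC y).
  by rewrite distrC (distrC x) !ger0_norm ?subr_ge0 ?G_mono ?G_lip.
have G_cont : continuous G.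
  move=> x; apply/cvgrPdist_le => e e0; near=> y.
  by apply: le_trans (G_dist _ _) _; near: y; exact: cvgr_dist_le.
have G0 : G 0 = 0.
  apply: le_anti; rewrite fine_ge0// andbT -lee_fin fineK; last first.
    exact/fin/measurable_itvL.
  apply: (@le_trans _ _ (leb (`[0%R, 0%R]%classic : set R))).
    apply: le_measure; rewrite ?inE; [apply: measurableI => //| |].
    - exact: measurable_itvL.
    - exact: measurable_itvL.
    - by move=> t [/Ab]; rewrite /= !in_itv/= => /andP[-> _].
  by rewrite lebesgue_itv lebesgue_measure_itv/= ltxx.
have Gb : 0 < G b.
  rewrite -lte_fin fineK; last exact/fin/measurable_itvL.
  by rewrite setIidl// => t /Ab /=; rewrite !in_itv/= => /andP[_ ->].
have /choice[c cP] n : exists x, x <= b /\ G x = G b * (1 - n.+1%:R^-1).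
  have n0 : 0 < n.+1%:R^-1 :> R by rewrite invr_gt0.
  have n1 : n.+1%:R^-1 <= 1 :> R by rewrite invf_le1// ler1n.
  have [||x] := @IVT R G 0 b (G b * (1 - n.+1%:R^-1)) b0.
  - exact: continuous_subspaceT.
  - rewrite G0 (min_l (ltW Gb)) (max_r (ltW Gb)).
    by rewrite mulr_ge0 ?subr_ge0 ?(ltW Gb)//= ler_piMr ?(ltW Gb)// gerBl ltW.
  - by rewrite in_itv/= => /andP[_ xb] Gx; exists x.
have Gc_lt n : G (c n) < G (c n.+1).
  rewrite (cP n).2 (cP n.+1).2 ltr_pM2l// ltrD2l ltrN2.
  by rewrite ltf_pV2 ?posrE// ltr_nat.
have c_lt n : c n < c n.+1.
  by rewrite ltNge; apply/negP => /G_mono; rewrite leNgt Gc_lt.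
exists c; split=> [//|n|n]; first exact: (cP n).1.
by rewrite -GB ?ltW// lte_fin subr_gt0.
Unshelve. all: by end_near. Qed.
End lebesgue_splitting.

(** * Combinations of normalised indicators of disjoint sets *)

Lemma cvg_series_single {R : realType} (u : nat -> R) k :
  (forall n, n != k -> u n = 0) -> series u @ \oo --> u k.
Proof.
move=> uk; rewrite -(cvg_shiftn k.+1); apply: cvg_near_cst; apply: nearW => n.
have kn : (k < n + k.+1)%N by exact: leq_addl.
rewrite /series/= big_mkord (bigD1 (Ordinal kn))//= big1 ?addr0// => i ik.
exact: uk.
Qed.

Section step_functions.
Context d (T : measurableType d) (R : realType)
  (mu : {measure set T -> \bar R}) (E : nat -> set T).
Hypothesis mE : forall n, measurable (E n).
Hypothesis trivE : trivIset setT E.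
Implicit Types a b : nat -> R.

Definition block n (t : T) : R := (fine (mu (E n)))^-1 * \1_(E n) t.

(** The pointwise limit makes sense for every sequence [a], because at most one
    term of the series is nonzero at a given point. *)
Definition step a (t : T) : R := limn (series (fun n => a n * block n t)).

Lemma block_ge0 n t : 0 <= block n t.
Proof. by rewrite mulr_ge0// invr_ge0 fine_ge0. Qed.

Lemma measurable_block n : measurable_fun setT (block n).
Proof. by apply: measurable_funM => //; exact: measurable_indic. Qed.

Lemma block_single t : exists k, forall n, n != k -> block n t = 0.
Proof.
have block0 n : ~ E n t -> block n t = 0.
  by move=> nE; rewrite /block indicE memNset// mulr0.
have [[k Ek]|nE] := pselect (exists k, E k t).
  exists k => n nk; apply: block0 => En; move/eqP : nk; apply.
  by apply: (trivE I I); exists t.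
by exists 0%N => n _; apply: block0 => En; apply: nE; exists n.
Qed.

Lemma cvg_step a t : series (fun n => a n * block n t) @ \oo --> step a t.
Proof.
have [k kP] := block_single t.
have c : series (fun n => a n * block n t) @ \oo --> a k * block k t.
  by apply: cvg_series_single => n /kP ->; rewrite mulr0.
by rewrite /step (cvg_lim _ c).
Qed.

(** One index serves all coefficient sequences at once, so identities between
    step functions reduce to identities between reals. *)
Lemma stepE t : exists k, forall a, step a t = a k * block k t.
Proof.
have [k kP] := block_single t; exists k => a.
apply/cvg_lim => //; apply: cvg_series_single => n /kP ->.
by rewrite mulr0.
Qed.

Lemma measurable_step a : measurable_fun setT (step a).
Proof.
apply: (@measurable_fun_cvg _ _ _ _ (fun N t => \sum_(0 <= n < N) a n * block n t)).
  move=> N; apply: measurable_sum => n.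
  by apply: measurable_funM => //; exact: measurable_block.
by move=> t _; exact: cvg_step.
Qed.

Lemma step_comb (c e : R) a b t :
  step (fun n => c * a n + e * b n) t = c * step a t + e * step b t.
Proof. by have [k kP] := stepE t; rewrite !kP; ring. Qed.

Lemma normr_step a t : `|step a t| = step (fun n => `|a n|) t.
Proof.
by have [k kP] := stepE t; rewrite !kP normrM (ger0_norm (block_ge0 k t)).
Qed.

(** Disjointness of the supports gives |sum a_n block_n| = sum |a_n| block_n;
    then monotone convergence applies. *)
Lemma integral_step a (D : set T) : measurable D ->
  (\int[mu]_(t in D) (`|step a t|)%:E =
   \sum_(n <oo) (`|a n|)%:E * \int[mu]_(t in D) (block n t)%:E)%E.
Proof.
move=> mD.
have mb n : measurable_fun D (fun t => (block n t)%:E).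
  exact/measurable_EFinP/measurable_funTS/measurable_block.
transitivity (\int[mu]_(t in D) \sum_(n <oo) ((`|a n|)%:E * (block n t)%:E))%E.
  apply: eq_integral => t _; rewrite normr_step.
  have cs : series (fun n => `|a n| * block n t) @ \oo -->
    step (fun n => `|a n|) t by exact: cvg_step.
  rewrite /step -EFin_lim; last by apply/cvg_ex; exists (step (fun n => `|a n|) t).
  by congr (limn _); apply/funext => N /=; rewrite /series/= -sumEFin.
rewrite integral_nneseries//.
- apply: eq_eseriesr => n _; rewrite ge0_integralZl_EFin//.
  by move=> t _; rewrite lee_fin block_ge0.
- by move=> n; exact: measurable_funeM.
- by move=> n t _; rewrite mule_ge0// lee_fin block_ge0.
Qed.

End step_functions.

(** * Comparison of norms in the Volterra space *)

Section volterra_ideal.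
Context {R : realType} {I : volterra_domain} (X : banach_function_space R I).
Local Notation mu := (lebesgue_on R I).
Local Notation leb := (lebesgue R).
Implicit Types f g h : L0 mu.

Lemma ae_domain : \forall x \ae mu, domain_set R I x.
Proof. by apply/ae_lebesgue_onP; exact: aeW. Qed.

Lemma volterra_absE f (g : lebesgue_line R -> R) (x : R) :
  measurable_fun setT g -> (\forall t \ae mu, f t = g t) -> domain_set R I x ->
  volterra_abs f x = (\int[leb]_(t in `[0%R, x]%classic) (`|g t|)%:E)%E.
Proof.
move=> mg /ae_lebesgue_onP fg Ix; have mx := measurable_itvL `[0, x].
have mabs (k : lebesgue_line R -> R) : measurable_fun setT k ->
    measurable_fun (`[0%R, x]%classic : set (lebesgue_line R))
      (fun t => (`|k t|)%:E).
  move=> mk; apply/measurable_EFinP/measurable_funTS.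
  exact: measurableT_comp.
apply: ge0_ae_eq_integral => //.
- by apply: mabs; exact: L0_measurable.
- exact: mabs.
- apply: filterS fg => t fgt xt; congr (`|_|%:E); apply: fgt.
  exact: itv_sub_domain xt.
Qed.

Lemma volterra_carrierP f : f \in volterra_carrier X <->
  (\forall x \ae mu, volterra_abs f x < +oo)%E /\
  L0_volterra_abs f \in ns_carrier X.
Proof. by split=> [/set_mem|/mem_set]. Qed.

Lemma bfs_ideal_scaled f h (a : R) : f \in ns_carrier X ->
  (\forall x \ae mu, `|h x| <= `|a * f x|) ->
  h \in ns_carrier X /\ ns_norm X h <= `|a| * ns_norm X f.
Proof.
move=> fX hf; have [X0 Xlin] := ns_submod_closed X.
have afX : a *: f \in ns_carrier X by rewrite -[_ *: _]addr0; exact: Xlin.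
rewrite -ns_normZ//; apply: bfs_ideal => //.
by apply: filterS2 hf (L0_scaleE a f) => x + ->.
Qed.

(** Only the Volterra transforms have to be compared, not the functions: this is
    stronger than the ideal property of the Volterra space, and it is what allows
    to compare functions with disjoint supports. *)
Lemma le_volterra_norm f h (a : R) : 0 <= a -> f \in volterra_carrier X ->
  (forall x, domain_set R I x ->
    (volterra_abs h x <= a%:E * volterra_abs f x)%E) ->
  h \in volterra_carrier X /\ volterra_norm X h <= a * volterra_norm X f.
Proof.
move=> a0 /volterra_carrierP[foo fX] hf.
have hoo : \forall x \ae mu, (volterra_abs h x < +oo)%E.
  apply: filterS2 ae_domain foo => x /hf/le_lt_trans + fx; apply.
  by rewrite lte_mul_pinfty// lee_fin.
have [|hX hN] := @bfs_ideal_scaled _ (L0_volterra_abs h) a fX.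
  apply: filterS3 (filterI (L0_volterra_absE h) (L0_volterra_absE f)) ae_domain
    (filterI hoo foo) => x [-> ->] Ix [hx fx].
  have ffin : volterra_abs f x \is a fin_num.
    by rewrite ge0_fin_numE// volterra_abs_ge0.
  have hfin : volterra_abs h x \is a fin_num.
    by rewrite ge0_fin_numE// volterra_abs_ge0.
  rewrite !ger0_norm ?mulr_ge0 ?fine_ge0 ?volterra_abs_ge0//.
  by rewrite -lee_fin EFinM !fineK// hf.
split; first exact/volterra_carrierP.
by rewrite -[X in X * _]ger0_norm.
Qed.

Lemma volterra_carrier_dominated f h (a : R) : 0 <= a ->
  f \in volterra_carrier X -> (\forall t \ae mu, `|h t| <= a * `|f t|) ->
  h \in volterra_carrier X.
Proof.
move=> a0 fV hf.
(* The constant is a + 1 since volterra_abs_le is applied with f as both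
   dominating functions. *)
have [] // := @le_volterra_norm f h (a + 1) _ fV; first by rewrite addr_ge0.
move=> x Ix; rewrite EFinD ge0_muleDl ?lee_fin// mul1e.
apply: volterra_abs_le => //; apply: filterS hf => t; move/le_trans; apply.
by rewrite lerDl.
Qed.

End volterra_ideal.

(** * Consecutive blocks in the Volterra space *)

Section staircase.
Context {R : realType} {I : volterra_domain} (X : banach_function_space R I).
Local Notation mu := (lebesgue_on R I).
Local Notation leb := (lebesgue R).
Local Notation VX := (ns_type (volterra_space X)).

Variables (A : set (lebesgue_line R)) (b : R) (c : nat -> R).
Hypothesis mA : measurable A.
Hypothesis Ab : A `<=` `[0%R, b]%classic.
Hypothesis c_lt : forall n, c n < c n.+1.
Hypothesis c_le : forall n, c n <= b.
Hypothesis Ac_gt0 : forall n, (0 < leb (A `&` `]c n, c n.+1]%classic))%E.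
Implicit Types (a : nat -> R) (x : R).

Definition slice n : set (lebesgue_line R) := A `&` `]c n, c n.+1]%classic.

Lemma measurable_slice n : measurable (slice n).
Proof. by apply: measurableI => //; exact: measurable_itvL. Qed.

Lemma c_mono m n : (m < n)%N -> c m.+1 <= c n.
Proof.
have c_nd : {homo c : m n / (m <= n)%N >-> m <= n}.
  by apply/nondecreasing_seqP => k; exact: ltW.
by move=> mn; exact: c_nd.
Qed.

Lemma trivIset_slice : trivIset setT slice.
Proof.
apply/trivIsetP => m n _ _.
wlog mn : m n / (m < n)%N.
  move=> h; rewrite neq_ltn => /orP[mn|nm]; first by rewrite h// ltn_eqF.
  by rewrite setIC h// ltn_eqF.
move=> _; apply/seteqP; split=> // t [[_ /=]].
rewrite in_itv/= => /andP[_ tm] [_ /=]; rewrite in_itv/= => /andP[tn _].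
by have := lt_le_trans tn (le_trans tm (c_mono mn)); rewrite ltxx.
Qed.

Lemma slice_fin n : leb (slice n) \is a fin_num.
Proof.
rewrite ge0_fin_numE//.
apply: (@le_lt_trans _ _ (leb (`[0%R, b]%classic : set R))).
  apply: le_measure; rewrite ?inE; [exact: measurable_slice|exact: measurable_itvL|].
  by move=> t [/Ab].
by rewrite lebesgue_itv lebesgue_measure_itv/= lte_fin; case: ifP => _; rewrite ltry.
Qed.

Lemma slice_gt0 n : 0 < fine (leb (slice n)).
Proof. by rewrite -lte_fin fineK ?slice_fin//; exact: Ac_gt0. Qed.

Local Notation bl := (block leb slice).

(** The Volterra transform of the n-th block: 0 up to [c n], 1 from [c n.+1]
    on. *)
Definition ramp n x : \bar R := (\int[leb]_(t in `[0%R, x]%classic) (bl n t)%:E)%E.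

Lemma rampE n x : ramp n x =
  ((fine (leb (slice n)))^-1%:E * leb (slice n `&` `[0%R, x]%classic))%E.
Proof.
have mx := measurable_itvL `[0, x].
rewrite /ramp; under eq_integral do rewrite EFinM.
rewrite ge0_integralZl_EFin//.
- by rewrite integral_indic//; exact: measurable_slice.
- apply/measurable_EFinP/measurable_funTS/measurable_indic.
  exact: measurable_slice.
Qed.

Lemma ramp_ge0 n x : (0 <= ramp n x)%E.
Proof. by rewrite rampE mule_ge0// lee_fin invr_ge0 ltW// slice_gt0. Qed.

Lemma ramp_le1 n x : (ramp n x <= 1)%E.
Proof.
rewrite rampE lee_pdivrMl ?slice_gt0// mule1 fineK ?slice_fin//.
apply: le_measure; rewrite ?inE; last by move=> t [].
  by apply: measurableI; [exact: measurable_slice|exact: measurable_itvL].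
exact: measurable_slice.
Qed.

Lemma ramp_eq0 n x : x <= c n -> ramp n x = 0%E.
Proof.
move=> xc; rewrite rampE (_ : _ `&` _ = set0) ?measure0 ?mule0//.
apply/seteqP; split=> // t [[_ /=]]; rewrite !in_itv/= => /andP[ct _] /andP[_ tx].
by have := lt_le_trans ct (le_trans tx xc); rewrite ltxx.
Qed.

Lemma ramp_eq1 n x : c n.+1 <= x -> ramp n x = 1%E.
Proof.
move=> cx; rewrite rampE setIidl.
  by rewrite -[X in (_ * X)%E]fineK ?slice_fin// -EFinM mulVf// gt_eqF// slice_gt0.
move=> t [/Ab /= + /=]; rewrite !in_itv/= => /andP[-> _] /andP[_ tc].
exact: le_trans cx.
Qed.

(** If [m < n], the m-th ramp has reached 1 before the n-th one leaves 0. *)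
Lemma ramp_decr m n x : (m <= n)%N -> (ramp n x <= ramp m x)%E.
Proof.
rewrite leq_eqVlt => /predU1P[->//|mn].
have [xc|cx] := leP x (c n); first by rewrite ramp_eq0// ramp_ge0.
by rewrite [leRHS]ramp_eq1 ?ramp_le1// (le_trans (c_mono mn))// ltW.
Qed.

Definition step_class a : L0 mu :=
  L0_class mu (measurable_step leb measurable_slice trivIset_slice a).

Lemma step_classK a : \forall t \ae mu, step_class a t = step leb slice a t.
Proof. exact: L0_classK. Qed.

Lemma step_class_comb (d e : R) a a' :
  step_class (fun n => d * a n + e * a' n) =
  d *: step_class a + e *: step_class a'.
Proof.
apply/L0_eqP.
apply: filterS3 (filterI (step_classK (fun n => d * a n + e * a' n))
    (L0_addE (d *: step_class a) (e *: step_class a')))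
  (filterI (L0_scaleE d (step_class a)) (step_classK a))
  (filterI (L0_scaleE e (step_class a')) (step_classK a')).
move=> t [-> ->] [-> ->] [-> ->].
by rewrite step_comb//; exact: trivIset_slice.
Qed.

(** The factor [d] is kept because the lower estimate for the norm compares a
    combination with a multiple of a single block. *)
Lemma step_delta (d : R) n t :
  step leb slice (fun k => d * (k == n)%:R) t = d * bl n t.
Proof.
apply/cvg_lim => //.
have /= := @cvg_series_single R (fun k => d * (k == n)%:R * bl k t) n.
by rewrite eqxx mulr1; apply => k /negPf ->; rewrite mulr0 mul0r.
Qed.

(** The Volterra transform of the absolute value of a combination of blocks. *)
Definition weight a x : \bar R := (\sum_(n <oo) (`|a n|)%:E * ramp n x)%E.

Lemma volterra_abs_step a x : domain_set R I x ->
  volterra_abs (step_class a) x = weight a x.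
Proof.
move=> Ix; rewrite (volterra_absE (measurable_step leb measurable_slice trivIset_slice a)
   (step_classK a) Ix).
rewrite integral_step//; [exact: measurable_slice|exact: trivIset_slice|].
exact: measurable_itvL.
Qed.

Lemma weight_delta (d : R) n x :
  weight (fun k => d * (k == n)%:R) x = ((`|d|)%:E * ramp n x)%E.
Proof.
have mx := measurable_itvL `[0, x].
rewrite /weight -integral_step//; [|exact: measurable_slice|exact: trivIset_slice].
under eq_integral do rewrite step_delta normrM (ger0_norm (block_ge0 _ _ _ _)) EFinM.
rewrite ge0_integralZl_EFin//.
- by move=> t _; rewrite lee_fin block_ge0.
- exact/measurable_EFinP/measurable_funTS/measurable_block/measurable_slice.
Qed.

Lemma weight_le a x : ell1 a -> (weight a x <= (ell1_norm a)%:E * ramp 0 x)%E.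
Proof.
move=> la; apply: lime_le.
  by apply: is_cvg_nneseries => n _ _; rewrite mule_ge0// ?lee_fin// ramp_ge0.
apply: nearW => N; apply: (@le_trans _ _ ((\sum_(0 <= n < N) `|a n|)%:E * ramp 0 x)%E).
  rewrite -sumEFin ge0_sume_distrl; last by move=> n _; rewrite lee_fin.
  by apply: lee_sum => n _; rewrite lee_wpmul2l ?lee_fin// ramp_decr.
by rewrite lee_wpmul2r ?ramp_ge0// lee_fin sum_le_ell1_norm.
Qed.

Lemma weight_ge a N x :
  ((\sum_(0 <= n < N) `|a n|)%:E * ramp N x <= weight a x)%E.
Proof.
rewrite /weight; apply: le_trans (nneseries_lim_ge N _); last first.
  by move=> n _ _; rewrite mule_ge0// ?lee_fin// ramp_ge0.
rewrite -sumEFin ge0_sume_distrl; last by move=> n _; rewrite lee_fin.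
rewrite !big_mkord; apply: lee_sum => n _.
by rewrite lee_wpmul2l ?lee_fin// ramp_decr// ltnW.
Qed.


Variables (f : L0 mu) (k : R).
Hypothesis fX : f \in volterra_carrier X.
Hypothesis k0 : 0 <= k.
Hypothesis fA : forall t, A t -> 1 <= k * `|f t|.

Definition unit_seq n : nat -> R := fun j => (j == n)%:R.

Lemma ell1_unit_seq n : ell1 (unit_seq n).
Proof.
apply: (@ell1_finite _ _ n.+1) => j nj.
by rewrite /unit_seq gtn_eqF.
Qed.

Lemma scale_step_class (d : R) a :
  step_class (fun n => d * a n) = d *: step_class a.
Proof.
have := step_class_comb d 0 a a; rewrite scale0r addr0 => <-.
by congr step_class; apply/funext => n; rewrite mul0r addr0.
Qed.

Lemma volterra_abs_unit n x : domain_set R I x ->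
  volterra_abs (step_class (unit_seq n)) x = ramp n x.
Proof.
move=> Ix; rewrite volterra_abs_step//.
have := weight_delta 1 n x; under eq_fun do rewrite mul1r.
by rewrite normr1 mul1e.
Qed.

Lemma unit0_in : step_class (unit_seq 0) \in volterra_carrier X.
Proof.
have q0 : 0 <= (fine (leb (slice 0)))^-1 by rewrite invr_ge0 ltW// slice_gt0.
apply: (volterra_carrier_dominated (mulr_ge0 q0 k0) fX).
apply: filterS (step_classK (unit_seq 0)) => t ->.
have := step_delta 1 0 t; under eq_fun do rewrite mul1r.
rewrite mul1r => ->; rewrite ger0_norm ?block_ge0// /block -mulrA ler_wpM2l//.
rewrite indicE; have [At|nAt] := boolP (t \in slice 0).
  by apply: fA; move/set_mem : At => -[].
by rewrite mulr_ge0.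
Qed.

(** An infinite combination of blocks is dominated, after Volterra transform, by
    a multiple of the first block, since every ramp lies below the first one. *)
Lemma step_class_in a : ell1 a ->
  step_class a \in volterra_carrier X /\
  volterra_norm X (step_class a) <=
    ell1_norm a * volterra_norm X (step_class (unit_seq 0)).
Proof.
move=> la; apply: le_volterra_norm; [exact: ell1_norm_ge0|exact: unit0_in|].
by move=> x Ix; rewrite volterra_abs_unit// volterra_abs_step// weight_le.
Qed.

Definition step_vec a (la : ell1 a) : VX :=
  @NsType R _ (volterra_space X) _ (step_class_in la).1.

Definition basis_vec n : VX := step_vec (@ell1_unit_seq n).

Lemma step_vec_norm a (la : ell1 a) : `|step_vec la| = volterra_norm X (step_class a).
Proof. by []. Qed.

Definition trunc a N : nat -> R := fun n => if (n < N)%N then a n else 0.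

Lemma ell1_trunc a N : ell1 (trunc a N).
Proof. by apply: (@ell1_finite _ _ N) => n Nn; rewrite /trunc ltnNge Nn. Qed.

Lemma sum_basis_vec a N :
  \sum_(0 <= n < N) a n *: basis_vec n = step_vec (@ell1_trunc a N).
Proof.
apply: val_inj; elim: N => [|N ih] /=.
  rewrite big_geq//=; have := scale_step_class 0 (trunc a 0).
  rewrite scale0r => <-; congr step_class.
  by apply/funext => n; rewrite mul0r.
rewrite big_nat_recr//= -[LHS]/(ns_val _ + a N *: ns_val (basis_vec N)).
rewrite [X in X + _]ih /= -[X in X + _]scale1r -step_class_comb.
congr step_class; apply/funext => n; rewrite mul1r /trunc /unit_seq ltnS [(n <= N)%N]leq_eqVlt.
have [->|nN] := eqVneq n N; first by rewrite ltnn add0r mulr1.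
by rewrite mulr0 addr0.
Qed.

(** The N-th ramp lies below all the previous ones, hence its multiple by the
    sum of the [`|a n|] lies below the transform of the combination. *)
Lemma basis_vec_lower a N :
  (\sum_(0 <= n < N) `|a n|) * `|basis_vec N| <=
  `|\sum_(0 <= n < N) a n *: basis_vec n|.
Proof.
rewrite sum_basis_vec step_vec_norm; set S := \sum_(_ <= _ < _) _.
have S0 : 0 <= S by rewrite sumr_ge0.
have -> : S * `|basis_vec N| = `|S *: basis_vec N| by rewrite normrZ ger0_norm.
rewrite -[`|_ *: _|]/(volterra_norm X (S *: step_class (unit_seq N))).
rewrite -scale_step_class -[leRHS]mul1r.
have [] // := @le_volterra_norm _ _ X (step_class (trunc a N))
  (step_class (fun n => S * unit_seq N n)) 1 ler01 (step_class_in (@ell1_trunc a N)).1.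
move=> x Ix; rewrite !volterra_abs_step// mul1e weight_delta ger0_norm//.
apply: le_trans (weight_ge (trunc a N) N x).
rewrite le_eqVlt; apply/orP; left; apply/eqP; congr (_%:E * _)%E.
by apply: eq_big_nat => n /andP[_ nN]; rewrite /trunc nN.
Qed.

Lemma basis_vec_decr : nonincreasing_seq (fun n => `|basis_vec n|).
Proof.
apply/nonincreasing_seqP => n; rewrite !step_vec_norm -[leRHS]mul1r.
have [] // := @le_volterra_norm _ _ X (step_class (unit_seq n))
  (step_class (unit_seq n.+1)) 1 ler01 (step_class_in (@ell1_unit_seq n)).1.
by move=> x Ix; rewrite !volterra_abs_unit// mul1e ramp_decr.
Qed.

(** The difference between the pointwise sum and a partial sum is the step
    function of the tail of [a], whose norm is controlled by the l^1 norm of that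
    tail. *)
Lemma cvg_basis_vec a : ell1 a -> cvgn (series (fun n => a n *: basis_vec n)).
Proof.
move=> la; apply/cvg_ex; exists (step_vec la); apply/cvgrPdist_le => e e0.
have : (fun N => ell1_norm (fun n => a n - trunc a N n) * `|basis_vec 0|) @ \oo -->
    0 * `|basis_vec 0| by apply: cvgMl; exact: ell1_tail_cvg0.
rewrite mul0r => /cvgrPdist_le/(_ e e0); apply: filterS => N.
rewrite sub0r normrN; apply: le_trans; apply: le_trans (ler_norm _).
rewrite /series/= sum_basis_vec.
have lt := ell1B la (@ell1_trunc a N).
rewrite -[`|_ - _|]/(volterra_norm X (step_class a - step_class (trunc a N))).
have -> : step_class a - step_class (trunc a N) =
    step_class (fun n => a n - trunc a N n).
  rewrite -[step_class a]scale1r -scaleN1r -step_class_comb.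
  by congr step_class; apply/funext => n; rewrite mul1r mulN1r.
exact: (step_class_in lt).2.
Qed.

Hypothesis tail : (0 < leb (domain_set R I `&` `]b, +oo[%classic))%E.

(** All the ramps equal 1 beyond [b], so the norm in [X] of this indicator bounds
    the norms of all the basis vectors from below. *)
Definition tail_class : L0 mu :=
  L0_class mu (measurable_indic (measurable_itvL `]b, +oo[)).

Lemma tail_class_le n : tail_class \in ns_carrier X /\
  ns_norm X tail_class <= `|basis_vec n|.
Proof.
have [_ yX] := (volterra_carrierP X _).1 (step_class_in (@ell1_unit_seq n)).1.
rewrite step_vec_norm; apply: bfs_ideal => //.
apply: filterS3 (ae_domain (R := R) (I := I))
  (L0_classK mu (measurable_indic (measurable_itvL `]b, +oo[)))
  (L0_volterra_absE (step_class (unit_seq n))) => x Ix -> ->.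
rewrite volterra_abs_unit// indicE; have [bx|nbx] := boolP (_ \in _).
  rewrite ramp_eq1//; apply: le_trans (c_le n.+1) _.
  by move/set_mem: bx => /=; rewrite in_itv/= andbT => /ltW.
by rewrite normr0.
Qed.

Lemma tail_class_norm_gt0 : 0 < ns_norm X tail_class.
Proof.
have UX := (tail_class_le 0).1.
rewrite -[ltRHS]/(`|@NsType R _ (bfs_space X) _ UX|) normr_gt0.
apply/eqP => /(congr1 (fun u => ns_val u)) /= U0.
have /ae_lebesgue_onP[N [mN N0 UN]] : \forall x \ae mu, \1_(`]b, +oo[%classic) x = 0 :> R.
  apply: filterS2 (L0_classK mu (measurable_indic (measurable_itvL `]b, +oo[)))
    (L0_zeroE mu) => x <- <-.
  by rewrite -/tail_class U0.
have : (leb (domain_set R I `&` `]b, +oo[%classic) <= leb N)%E.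
  apply: le_measure; rewrite ?inE//.
    by apply: measurableI; [exact: measurable_domain|exact: measurable_itvL].
  move=> x [Ix bx]; apply: UN => /= /(_ Ix).
  by rewrite indicE mem_set// => /eqP; rewrite oner_eq0.
by rewrite N0 leNgt tail.
Qed.

Lemma staircase_ai_l1 : contains_ai_l1 VX.
Proof.
apply: (@dominating_ai_l1 _ _ basis_vec (ns_norm X tail_class)).
- exact: tail_class_norm_gt0.
- by move=> n; exact: (tail_class_le n).2.
- exact: basis_vec_decr.
- exact: basis_vec_lower.
- exact: cvg_basis_vec.
Qed.

End staircase.

(** * Existence of the blocks *)

Section nontrivial.
Context {R : realType} {I : volterra_domain}.
Local Notation mu := (lebesgue_on R I).
Local Notation leb := (lebesgue R).

(** Almost everywhere only: on [0, 1] the endpoint 1 is not covered, as some of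
    the domain must remain to the right of each [b n]. *)
Lemma domain_exhaustion : exists b : nat -> R,
  (forall n, (0 < leb (domain_set R I `&` `]b n, +oo[%classic))%E) /\
  (\forall t \ae leb, domain_set R I t -> exists n, t <= b n).
Proof.
have pos (x y : R) : x < y -> `]x, y]%classic `<=` domain_set R I ->
    (0 < leb (domain_set R I `&` `]x, +oo[%classic))%E.
  move=> xy xyI; apply: (@lt_le_trans _ _ (leb (`]x, y]%classic : set R))).
    by rewrite lebesgue_itv lebesgue_measure_itv/= lte_fin xy -EFinB lte_fin subr_gt0.
  apply: le_measure; rewrite ?inE; first exact: measurable_itvL.
    by apply: measurableI; [exact: measurable_domain|exact: measurable_itvL].
  move=> t xt; split; first exact: xyI.
  by move: xt; rewrite /= !in_itv/= andbT => /andP[].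
case: (domain_setE R I) => IE; rewrite IE in pos *.
- exists (fun n => 1 - n.+1%:R^-1); split=> [n|].
    apply: (pos _ 1); first by rewrite gtrBl invr_gt0.
    move=> t; rewrite /= !in_itv/= => /andP[tn ->]; rewrite andbT.
    by apply: le_trans (ltW tn); rewrite subr_ge0 invf_le1// ler1n.
  exists ([set (1 : R)] : set (lebesgue_line R)); split.
  + by apply: borel_measurable_lebesgue; exact: measurable_set1.
  + exact: lebesgue_measure_set1.
  + move=> t /= /not_implyP[]; rewrite in_itv/= => /andP[t0 t1] nt.
    apply/eqP; rewrite eq_le t1/= leNgt; apply/negP => lt1; apply: nt.
    have t1' : 0 < (1 : R) - t by rewrite subr_gt0.
    have [k _ /(_ k (leqnn k)) /= kt] := near_infty_natSinv_lt (PosNum t1').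
    by exists k; rewrite lerBrDr addrC -lerBrDr ltW.
- exists (fun n => n%:R); split=> [n|].
    apply: (pos _ n.+1%:R); first by rewrite ltr_nat.
    move=> t; rewrite /= !in_itv/= => /andP[tn _]; rewrite andbT.
    exact: le_trans (ltW tn).
  apply: aeW => t _; exists (Num.truncn t).+1.
  by rewrite ltW// truncnS_gt.
Qed.

(** Otherwise the countably many sets {t <= b n, 1 / (k + 1) <= |f t|} would all
    be null, and their union is almost all of {f <> 0}. *)
Lemma nonzero_superlevel (f : L0 mu) : f != 0 ->
  exists (A : set (lebesgue_line R)) (b k : R),
    [/\ measurable A, A `<=` `[0%R, b]%classic, (0 < leb A)%E &
        [/\ (0 < leb (domain_set R I `&` `]b, +oo[%classic))%E, 0 <= k &
            forall t, A t -> 1 <= k * `|f t|]].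
Proof.
move=> f0; have [b [btail bcover]] := domain_exhaustion.
pose A n k : set (lebesgue_line R) :=
  domain_set R I `&` `[0%R, b n]%classic `&`
  ((fun t => `|f t|) @^-1` `[k.+1%:R^-1, +oo[%classic).
have mA n k : measurable (A n k).
  apply: measurableI.
    by apply: measurableI; [exact: measurable_domain|exact: measurable_itvL].
  rewrite -[X in measurable X]setTI.
  have mf : measurable_fun setT (fun t => `|f t|).
    by apply: measurableT_comp => //; exact: L0_measurable.
  exact: mf.
have [[n [k Apos]]|nA] := pselect (exists n k, (0 < leb (A n k))%E).
  exists (A n k), (b n), k.+1%:R; split=> //; first by move=> t [[]].
  split=> // t [_ /=]; rewrite in_itv/= andbT => ft.
  by rewrite -ler_pdivrMl// mulr1.
have A0 n k : \forall t \ae leb, ~ A n k t.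
  exists (A n k); split=> //; last by move=> t /= /contrapT.
  apply/eqP; rewrite eq_le measure_ge0 andbT leNgt; apply/negP => Apos.
  by apply: nA; exists n, k.
case/eqP: f0; apply/L0_eqP.
suff : \forall t \ae mu, f t = 0.
  by move=> fz; apply: filterS2 fz (L0_zeroE mu) => t -> ->.
apply/ae_lebesgue_onP.
apply: filterS2 bcover (ae_foralln (fun n => ae_foralln (A0 n))) => t + tA It.
move=> /(_ It)[n tb]; apply: contrapT => /eqP ft0.
have ft : 0 < `|f t| by rewrite normr_gt0.
have [k _ /(_ k (leqnn k)) /= kt] := near_infty_natSinv_lt (PosNum ft).
apply: (tA n k); split; last by rewrite /= in_itv/= andbT ltW.
split=> //; rewrite /= in_itv/= tb andbT.
by case: (domain_setE R I) It => -> /=; rewrite in_itv/= => /andP[].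
Qed.

End nontrivial.

Theorem corollary8p4 (R : realType) (I : volterra_domain)
    (X : banach_function_space R I) :
  (exists f : ns_type (volterra_space X), f != 0) ->
  contains_ai_l1 (ns_type (volterra_space X)) /\
  ~ fixed_point_property (ns_type (volterra_space X)).
Proof.
move=> [[f fX] f0].
have fnz : f != 0 by apply: contraNN f0 => /eqP f0; apply/eqP/val_inj.
have [A [b [k [mA Ab A0 [tail k0 fA]]]]] := nonzero_superlevel fnz.
have [c [c_lt c_le Ac]] := exists_slicing mA Ab A0.
have ai : contains_ai_l1 (ns_type (volterra_space X)).
  exact: (staircase_ai_l1 mA Ab c_lt c_le Ac fX k0 fA tail).
by split=> //; exact: ai_l1_fails_fpp.
Qed.
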